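(* Let $G$ be the pseudoline arrangement graph of a simple arrangement of $n\ge 3$ pseudolines, and let $R(G)$ be its realization. A vertex $v$ of $G$ is a diametrical vertex of $G$ (i.e., its eccentricity equals the diameter of $G$) if and only if $v$ lies on the outer face of $R(G)$.
   Context: A pseudoline is a curve in the Euclidean plane $\mathbb{R}^2$ approaching a point at infinity in both directions (equivalently, the image of a line under a homeomorphism of the plane). A simple pseudoline arrangement is a finite collection $L$ of at least three pseudolines such that every two of them cross exactly once and no three pass through a common point. Its pseudoline arrangement graph $G$ has as vertices the intersection points of pairs of pseudolines of $L$, with two vertices adjacent if they lie on a common pseudoline $l\in L$ and no other vertex lies on the part of $l$ between them. The realization $R(G)$ is the plane drawing of $G$ obtained from the arrangement by deleting, from each pseudoline, the two unbounded pieces beyond its first and last intersection points; its outer face is the unbounded face of this drawing. The eccentricity of a vertex $u$ is $e(u)=\max_v d(u,v)$ with $d$ the shortest-path distance in $G$; the diameter of $G$ is the maximum eccentricity. *)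

(* Defs.v *)
From mathcomp Require Import all_boot all_order all_algebra.
From mathcomp Require Import all_classical all_reals all_analysis.

Set Implicit Arguments.
Unset Strict Implicit.
Unset Printing Implicit Defensive.

Import Order.TTheory GRing.Theory Num.Theory.
Import numFieldNormedType.Exports.

Local Open Scope classical_set_scope.
Local Open Scope ring_scope.

Definition line (R : realType) (m : set (R * R)) : Prop :=
  exists a b c : R, (a, b) != (0, 0) /\
    m = [set p | a * p.1 + b * p.2 = c].

Definition pseudoline (R : realType) (l : set (R * R)) : Prop :=
  exists (h g : R * R -> R * R) (m : set (R * R)),
    [/\ continuous h, continuous g, cancel h g, cancel g h
      & line m /\ l = h @` m].

(* [m] meets [l] in a single point and passes there from one side of [l] (one
   connected component of its complement) to the other.  For pseudolines this
   relation is symmetric. *)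
Definition cross_once (R : realType) (l m : set (R * R)) : Prop :=
  (exists p, l `&` m = [set p]) /\
  (exists x y, [/\ (m `\` l) x, (m `\` l) y
                 & ~ connected_component (~` l) x y]).

Definition simple_arrangement (R : realType) (n : nat)
    (L : 'I_n -> set (R * R)) : Prop :=
  [/\ forall i, pseudoline (L i),
      forall i j, i != j -> cross_once (L i) (L j)
    & forall i j k, i != j -> i != k -> j != k ->
        L i `&` L j `&` L k = set0].

Definition vertices (R : realType) (n : nat) (L : 'I_n -> set (R * R)) :
    set (R * R) :=
  [set p | exists i j, [/\ i != j, L i p & L j p]].

(* The open part of the curve [l] between its points [u] and [v]: the points
   whose removal from [l] disconnects [u] from [v]. *)
Definition between (R : realType) (l : set (R * R)) (u v : R * R) :
    set (R * R) :=
  [set w | [/\ l w, w <> u, w <> v & ~ connected_component (l `\ w) u v]].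

Definition adjacent (R : realType) (n : nat) (L : 'I_n -> set (R * R))
    (u v : R * R) : Prop :=
  [/\ vertices L u, vertices L v, u <> v
    & exists i, [/\ L i u, L i v & between (L i) u v `&` vertices L = set0]].

(* The distance is [+oo] between vertices joined by no walk. *)
Definition dist (R : realType) (n : nat) (L : 'I_n -> set (R * R))
    (u v : R * R) : \bar R :=
  ereal_inf [set (size p)%:R%:E |
    p in [set p | path (fun x y => `[< adjacent L x y >]) u p /\
                  last u p = v]].

Definition eccentricity (R : realType) (n : nat) (L : 'I_n -> set (R * R))
    (u : R * R) : \bar R :=
  ereal_sup [set dist L u v | v in vertices L].

Definition diameter (R : realType) (n : nat) (L : 'I_n -> set (R * R)) :
    \bar R :=
  ereal_sup [set eccentricity L u | u in vertices L].

Definition diametrical (R : realType) (n : nat) (L : 'I_n -> set (R * R))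
    (v : R * R) : Prop :=
  eccentricity L v = diameter L.

Definition unbounded_components (R : realType) (A : set (R * R)) :
    set (R * R) :=
  [set p | A p /\ ~ bounded_set (connected_component A p)].

Definition realization (R : realType) (n : nat) (L : 'I_n -> set (R * R)) :
    set (R * R) :=
  \bigcup_i (L i `\` unbounded_components (L i `\` vertices L)).

(* The realization is bounded, so its complement has exactly one unbounded
   component. *)
Definition outer_face (R : realType) (n : nat) (L : 'I_n -> set (R * R)) :
    set (R * R) :=
  unbounded_components (~` realization L).

(* Faces are open, so a point of the drawing lies on a face when it belongs to
   the topological boundary of that face, i.e. here to its closure. *)
Definition on_outer_face (R : realType) (n : nat) (L : 'I_n -> set (R * R))
    (v : R * R) : Prop :=
  closure (outer_face L) v.

(* Main.v *)
(* Record for every point p and every pseudoline c the side sg c p in {-1, 0, 1}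
   of c on which p lies.  Because two pseudolines cross once, these signs and the
   linear orders along the pseudolines determine distances combinatorially.

   Lower bound: along an edge the sum over c of |sg c x - sg c y| changes by at
   most 2, so two vertices that are weakly separated by all n lines are at
   distance at least n - 2.  A vertex on an unbounded cell is so separated from
   the last vertex at the opposite end of a line bounding that cell.

   Upper bound: inserting a line into an arrangement increases distances by at
   most one, since a walk can be rerouted along the new line between its first
   and last crossings with it.  Hence it suffices to join two vertices by N edges
   in a subarrangement of at least N + 2 lines to get d <= n - 2, and of at least
   N + 3 lines to get d <= n - 3.  For u on lines i, j and v on lines k, l, the
   lines i, j, k, l give d <= n - 2.  If u is on no unbounded cell, its cell
   opposite to v is cut off from infinity by one or two further lines, and these
   give d <= n - 3.

   Topologically, all cells are connected (by induction on the number of lines),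
   so an unbounded cell at u lies in the outer face.  If u is on no unbounded
   cell, the points weakly on the same sides as u form a bounded neighbourhood
   of u whose boundary belongs to the drawing. *)
Require Import Defs.
From mathcomp Require Import all_boot all_order all_algebra.
From mathcomp Require Import all_classical all_reals all_analysis.
From mathcomp Require Import zify ring lra.

Set Implicit Arguments.
Unset Strict Implicit.
Unset Printing Implicit Defensive.

Import Order.TTheory GRing.Theory Num.Theory.
Import numFieldNormedType.Exports.

Local Open Scope ring_scope.

(** * Sign vectors and walks *)

(* [sg c x] is the side of the line [c] on which [x] lies, [X i j] the crossing
   of [i] and [j], and [e k b] a point of [k] beyond all crossings, at the end [b]
   of [k].  The field [ray] encodes the linear order along [k]: points of [k] that
   [i] weakly separates from the crossing of [k] with [m] are on the same side of
   [m]. *)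
Record sign_system (I : finType) (P : Type) (sg : I -> P -> int)
    (X : I -> I -> P) (e : I -> bool -> P) : Prop := SignSystem {
  sgP : forall c x, [\/ sg c x = -1, sg c x = 0 | sg c x = 1];
  XC : forall i j, X i j = X j i;
  sgX : forall i j, i != j -> sg i (X i j) = 0;
  X_uniq : forall i j x, i != j -> sg i x = 0 -> sg j x = 0 -> x = X i j;
  sgX_neq0 : forall i j k, i != j -> i != k -> j != k -> sg k (X i j) <> 0;
  ray : forall i m k p q, i != m -> i != k -> m != k ->
    sg k p = 0 -> sg k q = 0 ->
    sg i p <> sg i (X k m) -> sg i q <> sg i (X k m) -> sg m p = sg m q;
  sg_end : forall k b, sg k (e k b) = 0;
  sg_end_neq0 : forall c k b, c != k -> sg c (e k b) <> 0;
  sg_end_opp : forall c k b, sg c (e k (~~ b)) = - sg c (e k b)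
}.

Lemma leq_count3 (T : eqType) (a b c d : pred T) (s : seq T) :
  {in s, forall x, (a x + b x + c x <= d x)%N} ->
  (count a s + count b s + count c s <= count d s)%N.
Proof.
elim: s => [|x s IHs] //= h.
have := h x (mem_head _ _).
have : (count a s + count b s + count c s <= count d s)%N.
  by apply: IHs => y ys; apply: h; rewrite inE ys orbT.
lia.
Qed.

Section Walks.
Variables (I : finType) (P : eqType) (sg : I -> P -> int).
Variables (X : I -> I -> P) (e : I -> bool -> P).
Hypothesis sgS : sign_system sg X e.

Let sgP := sgP sgS.
Let ray := ray sgS.

Definition sep c x y := (sg c x != 0) && (sg c y == - sg c x).

Definition vtx (S : seq I) x :=
  exists i j, [/\ i \in S, j \in S, i != j, sg i x = 0 & sg j x = 0].

(** A vertex of [S] strictly between [x] and [y] on [k] would be the crossing of [k] with a line of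
    [S] separating them. Thus the last clause makes [x] and [y] consecutive in the subarrangement
    [S]. *)
Definition adj S x y :=
  [/\ vtx S x, vtx S y, x <> y,
      exists2 k, k \in S & sg k x = 0 /\ sg k y = 0
    & forall c, c \in S -> ~~ sep c x y].

(* [N] is an upper bound on the number of edges. *)
Inductive walk S : nat -> P -> P -> Prop :=
| Walk0 N x : walk S N x x
| WalkS N x y z : adj S x y -> walk S N y z -> walk S N.+1 x z.

Lemma sepC c x y : sep c x y = sep c y x.
Proof. by rewrite /sep; case: (sgP c x) => ->; case: (sgP c y) => ->. Qed.

Lemma adj_sym S x y : adj S x y -> adj S y x.
Proof.
case=> vx vy xy [k kS [kx ky]] h; split=> //; first by move=> /esym.
  by exists k.
by move=> c /h; rewrite sepC.
Qed.

Lemma walk_le S N M x y : (N <= M)%N -> walk S N x y -> walk S M x y.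
Proof.
move=> + w; elim: w M => [{}N {}x M _|{}N {}x {}y z a _ IH [|M]] //.
  exact: Walk0.
by rewrite ltnS => NM; apply: WalkS a (IH _ NM).
Qed.

Lemma walk_cat S N M x y z :
  walk S N x y -> walk S M y z -> walk S (N + M) x z.
Proof.
move=> w; elim: w z => [{}N {}x|{}N {}x {}y z' a _ IH] z w.
  by apply: walk_le w; rewrite leq_addl.
by rewrite addSn; apply: WalkS a (IH _ w).
Qed.

Lemma walk1 S x y : adj S x y -> walk S 1 x y.
Proof. by move=> a; apply: WalkS a (Walk0 _ _ _). Qed.

Lemma walk_sym S N x y : walk S N x y -> walk S N y x.
Proof.
elim=> [{}N {}x|{}N {}x {}y z a _ IH]; first exact: Walk0.
by rewrite -addn1; apply: walk_cat IH (walk1 (adj_sym a)).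
Qed.

Lemma on3 i j k x : i != j -> i != k -> j != k ->
  sg i x = 0 -> sg j x = 0 -> sg k x <> 0.
Proof.
move=> ij ik jk ix jx; rewrite (X_uniq sgS ij ix jx).
exact: (sgX_neq0 sgS).
Qed.

Lemma on2 i j x y : i != j ->
  sg i x = 0 -> sg j x = 0 -> sg i y = 0 -> sg j y = 0 -> x = y.
Proof.
by move=> ij ix jx iy jy; rewrite (X_uniq sgS ij ix jx) -(X_uniq sgS ij iy jy).
Qed.

Lemma sgXr i j : i != j -> sg j (X i j) = 0.
Proof. by rewrite eq_sym => ij; rewrite (XC sgS) (sgX sgS). Qed.

Lemma btw k c c' p q : sg k p = 0 -> sg k q = 0 -> sep c p q -> c' != k ->
  c' != c ->
  sg c' (X k c) = sg c' p \/ sg c' (X k c) = sg c' q.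
Proof.
move=> kp kq s c'k c'c.
have ck : c != k by apply: contraTneq s => ->; rewrite /sep kp.
have [pz|/eqP pz] := eqVneq (sg c' p) (sg c' (X k c)); first by left.
have [qz|/eqP qz] := eqVneq (sg c' q) (sg c' (X k c)); first by right.
have := ray c'c c'k ck kp kq pz qz; move: s; rewrite /sep => /andP[/eqP c0 /eqP c1].
by lia.
Qed.

(** Summed over the lines, this says that cutting a segment of [k] at a crossing distributes its
    separating lines over the two pieces and loses [c] itself. It is the descent behind [straight]
    and [last_vertex]. *)
Lemma sep_btw k c c' p q : sg k p = 0 -> sg k q = 0 -> sep c p q ->
  (sep c' p (X k c) + sep c' (X k c) q + (c' == c) <= sep c' p q)%N.
Proof.
move=> kp kq s.
have ck : c != k by apply: contraTneq s => ->; rewrite /sep kp.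
have zk : sg k (X k c) = 0 by apply: (sgX sgS); rewrite eq_sym.
have zc : sg c (X k c) = 0 by apply: sgXr; rewrite eq_sym.
have [->|c'c] := eqVneq c' c.
  by rewrite s /sep zc; case: (sgP c p) => ->.
have [->|c'k] := eqVneq c' k; first by rewrite /sep kp zk.
have z0 : sg c' (X k c) <> 0 by apply: (sgX_neq0 sgS); rewrite eq_sym // eq_sym.
have := btw kp kq s c'k c'c.
rewrite /sep; case: (sgP c' p) => ->; case: (sgP c' q) => ->;
  case: (sgP c' (X k c)) z0 => -> //= z0 H; first [by case: z0 | by case: H].
Qed.

Lemma vtxX (S : seq I) i j : i \in S -> j \in S -> i != j -> vtx S (X i j).
Proof. by move=> iS jS ij; exists i, j; split=> //; rewrite ?(sgX sgS) ?sgXr. Qed.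

Definition nsep S x y := count (fun c => sep c x y) S.

(** The crossings with the separating lines cut the segment into edges. The induction splits at one
    of them, and the line lost in [sep_btw] pays for the additional edge. *)
Lemma straight S k x y : k \in S -> vtx S x -> vtx S y ->
  sg k x = 0 -> sg k y = 0 ->
  walk S (nsep S x y).+1 x y.
Proof.
move=> kS; move: {2}(nsep S x y).+1 (ltnSn (nsep S x y)) => N.
elim: N x y => // N IHN x y; rewrite ltnS => cN vx vy kx ky.
have [->|/eqP xy] := eqVneq x y; first exact: Walk0.
have [/hasP[c cS /= s]|/hasPn h] := boolP (has (fun c => sep c x y) S); last first.
  by apply: walk_le (walk1 _) => //; split=> //; exists k.
have ck : c != k by apply: contraTneq s => ->; rewrite /sep kx.
have zk : sg k (X k c) = 0 by apply: (sgX sgS); rewrite eq_sym.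
have vz : vtx S (X k c) by apply: vtxX => //; rewrite eq_sym.
have := leq_count3 (fun c' (_ : c' \in S) => sep_btw c' kx ky s).
rewrite -/(nsep S x (X k c)) -/(nsep S (X k c) y) -/(nsep S x y) => lec.
have : (0 < count (fun c' => c' == c) S)%N by rewrite -has_count; apply/hasP; exists c.
move=> c0.
have w1 := IHN x (X k c) ltac:(lia) vx vz kx zk.
have w2 := IHN (X k c) y ltac:(lia) vz vy zk ky.
by apply: walk_le (walk_cat w1 w2); lia.
Qed.

(** A line separating the points counts 2, and a line through exactly one of them counts 1. *)
Definition sgdist S x y := \sum_(c <- S) `|sg c x - sg c y|%N.

Lemma sgdist_tri S x y z : (sgdist S x z <= sgdist S x y + sgdist S y z)%N.
Proof. by rewrite -big_split /=; apply: leq_sum => c _; lia. Qed.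

Lemma sgdistC S x y : sgdist S x y = sgdist S y x.
Proof. by apply: eq_bigr => c _; lia. Qed.

Lemma sgdistxx S x : sgdist S x x = 0%N.
Proof. by rewrite /sgdist big1 // => c _; rewrite subrr. Qed.


Lemma sum_pred1_le (S : seq I) c : uniq S -> (\sum_(d <- S) (d == c) <= 1)%N.
Proof.
move=> uS; rewrite (eq_bigr (fun d => if d == c then 1%N else 0%N)) => [|d _].
  by rewrite -big_mkcond sum1_count count_uniq_mem // leq_b1.
by case: eqP.
Qed.

(* A vertex lies on only two lines, so moving along an edge of line [k] changes
   only the signs of the second lines through its two ends. *)
Lemma sgdist_adj S x y : uniq S -> adj S x y -> (sgdist S x y <= 2)%N.
Proof.
have two k x' : vtx S x' -> sg k x' = 0 ->
    exists c, forall d, sg d x' = 0 -> d != k -> d = c.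
  move=> [i [j [_ _ ij ix jx]]] kx.
  exists (if i == k then j else i) => d dx dk; have [ik|ik] := eqVneq i k.
    apply/eqP; apply/negPn/negP => dj; apply: (on3 _ _ _ kx dx jx) => //.
      by rewrite eq_sym.
    by rewrite -ik.
  apply/eqP; apply/negPn/negP => di; apply: (on3 _ _ _ kx dx ix) => //.
    by rewrite eq_sym.
  by rewrite eq_sym.
move=> uS [vx vy _ [k kS [kx ky]] h].
have [c1 h1] := two k x vx kx; have [c2 h2] := two k y vy ky.
rewrite (@leq_trans (\sum_(c <- S) (c == c1) + \sum_(c <- S) (c == c2)))%N //.
  rewrite -big_split /sgdist !big_seq; apply: leq_sum => c /h.
  have [->|ck] := eqVneq c k; first by rewrite kx ky.
  have := h1 c; have := h2 c; rewrite /sep.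
  case: (sgP c x) => ->; case: (sgP c y) => -> //= a b _.
  - by rewrite (a _ ck) // eqxx; lia.
  - by rewrite (b _ ck) // eqxx; lia.
  - by rewrite (b _ ck) // eqxx; lia.
  - by rewrite (a _ ck) // eqxx; lia.
by rewrite (leq_add (sum_pred1_le _ uS) (sum_pred1_le _ uS)).
Qed.

Lemma sgdist_walk S N x y : uniq S -> walk S N x y -> (sgdist S x y <= N.*2)%N.
Proof.
move=> uS; elim=> [{}N {}x|{}N {}x {}y z a _ IH]; first by rewrite sgdistxx.
by have := sgdist_tri S x y z; have := sgdist_adj uS a; lia.
Qed.

Lemma adj_cons S x y z : adj S y z -> ~~ sep x y z -> adj (x :: S) y z.
Proof.
have vc w : vtx S w -> vtx (x :: S) w.
  by move=> [i [j [iS jS ij iw jw]]]; exists i, j; rewrite !inE iS jS !orbT.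
case=> vy vz yz [k kS kyz] h s; split; [exact: vc|exact: vc|by []| |].
  by exists k => //; rewrite inE kS orbT.
by move=> c; rewrite inE => /predU1P[->//|/h].
Qed.

(** The new line [x] subdivides the edge at its crossing with the line [p] carrying it. From there
    to [w'] only the second line of [S] through [w'] changes its sign, and by 1, which gives the
    last bound. *)
Lemma adj_cross S x w w' : uniq (x :: S) -> adj S w w' -> sep x w w' ->
  exists2 p, p \in S & [/\ sg p w = 0, sg p w' = 0,
    adj (x :: S) w (X p x), adj (x :: S) (X p x) w'
    & (sgdist S (X p x) w' <= 1)%N].
Proof.
have vc w0 : vtx S w0 -> vtx (x :: S) w0.
  by move=> [i [j [iS jS ij iw jw]]]; exists i, j; rewrite !inE iS jS !orbT.
move=> /= /andP[xS uS] [vw vw' ww' [p pS [pw pw']] h] s.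
have px : p != x by apply: contraNneq xS => <-.
have pa : sg p (X p x) = 0 by apply: (sgX sgS).
have xa : sg x (X p x) = 0 by apply: sgXr.
have va : vtx (x :: S) (X p x) by apply: vtxX => //; rewrite inE ?eqxx ?pS ?orbT.
have x0 : sg x w != 0 by case/andP: s.
have x0' : sg x w' != 0 by move: s; rewrite sepC => /andP[].
have ca c : c \in S -> c != p -> sg c (X p x) <> 0.
  move=> cS cp; apply: (sgX_neq0 sgS) => //; first by rewrite eq_sym.
  by apply: contraNneq xS => ->.
have hc c : c \in S -> ~~ sep c w (X p x) && ~~ sep c (X p x) w'.
  move=> cS; have := sep_btw c pw pw' s.
  have -> : (c == x) = false by apply: contraNF xS => /eqP <-.
  by move: (h c cS); case: (sep c w w') => //; case: sep; case: sep.
exists p => //; split=> //.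
- split=> //; first exact: vc.
  + by move=> E; rewrite E xa in x0.
  + by exists p => //; rewrite inE pS orbT.
  + move=> c; rewrite inE => /predU1P[->|/hc/andP[]//].
    by rewrite sepC /sep xa.
- split=> //; first exact: vc.
  + by move=> E; rewrite -E xa in x0'.
  + by exists p => //; rewrite inE pS orbT.
  + move=> c; rewrite inE => /predU1P[->|/hc/andP[]//].
    by rewrite /sep xa.
- have [i [j [iS jS ij iw jw]]] := vw'.
  have [c [cS cp cw]] : exists c, [/\ c \in S, c != p & sg c w' = 0].
    have [ip|ip] := eqVneq i p; last by exists i.
    by exists j; split=> //; rewrite -ip eq_sym.
  apply: leq_trans (sum_pred1_le c uS).
  rewrite /sgdist !big_seq; apply: leq_sum => d dS.
  have [->|dp] := eqVneq d p; first by rewrite pa pw'.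
  have := ca d dS dp; have /andP[_] := hc d dS; rewrite /sep.
  have [->|dc] := eqVneq d c; first by rewrite cw; case: (sgP c (X p x)) => ->.
  have := on3 (i := p) (j := c) (k := d) (x := w').
  rewrite (eq_sym p) cp (eq_sym p) dp (eq_sym c) dc => /(_ isT isT isT pw' cw).
  by case: (sgP d (X p x)) => ->; case: (sgP d w') => ->.
Qed.

(** A walk with no edge cut by [x] survives. Otherwise it is split at its first cut edge, which
    accounts for the strict inequality. *)
Lemma first_cross S x N u v : walk S N u v -> walk (x :: S) N u v \/
  exists s r w w', [/\ walk (x :: S) s u w, adj S w w', sep x w w',
    walk S r w' v & (s + r < N)%N].
Proof.
elim=> [{}N {}u|{}N {}u y {}v a w IH]; first by left; apply: Walk0.
have [s|s] := boolP (sep x u y).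
  by right; exists 0%N, N, u, y; split=> //; exact: Walk0.
case: IH => [wy|[s' [r [w1 [w2 [? ? ? ? ?]]]]]].
  by left; apply: WalkS wy; apply: adj_cons.
right; exists s'.+1, r, w1, w2; split=> //.
by apply: WalkS (adj_cons a s) _.
Qed.

(* Between its first and last crossings with [x] the walk is rerouted along [x];
   comparing [sgdist] shows that the new part is not longer than the old one, up
   to the one extra edge. *)
Lemma walk_add_line S x N u v : uniq (x :: S) ->
  walk S N u v -> walk (x :: S) N.+1 u v.
Proof.
move=> uxS w; have /andP[xS uS] : (x \notin S) && uniq S by [].
case: (first_cross x w) => [w'|]; first exact: walk_le w'.
move=> [s [r [w0 [w1 [W0 a0 s0 W1 lsr]]]]].
have [p pS [pw0 pw1 aL aR dp]] := adj_cross uxS a0 s0.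
(* Reversing the remainder makes its first cut edge the last one of the walk. If there is none,
   subdividing the single cut edge costs one edge. *)
case: (first_cross x (walk_sym W1)) => [W|].
  have := walk_cat W0 (WalkS aL (WalkS aR (walk_sym W))).
  by apply: walk_le; lia.
move=> [r2 [r1 [z' [z [W2 a1 s1 W3 lr]]]]].
have [q qS [qz' qz bL bR dq]] := adj_cross uxS a1 s1.
(* If both cut edges lie on the same line, they are cut at the same point and everything in between
   is skipped. *)
have [pq|pq] := eqVneq p q.
  subst q; have := walk_cat W0 (WalkS aL (WalkS (adj_sym bL) (walk_sym W2))).
  by apply: walk_le; lia.
have ne c : c \in S -> x != c by move=> cS; apply: contraNneq xS => ->.
have xX c : c \in S -> sg x (X c x) = 0.
  by move=> /ne xc; apply: sgXr; rewrite eq_sym.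
have cX c : c \in S -> sg c (X c x) = 0.
  by move=> /ne xc; apply: (sgX sgS); rewrite eq_sym.
have vX c : c \in S -> vtx (x :: S) (X c x).
  by move=> cS; apply: vtxX; rewrite ?inE ?eqxx ?cS ?orbT // eq_sym ne.
have := straight (mem_head x S) (vX p pS) (vX q qS) (xX p pS) (xX q qS).
rewrite /nsep /= {1}/sep xX //= add0n.
rewrite -/(nsep _ _ _); set r0 := nsep _ _ _ => W4.
have D1 := sgdist_walk uS W3; have D2 := sgdist_tri S (X p x) w1 (X q x).
have D3 := sgdist_tri S w1 z (X q x).
rewrite (sgdistC S z) in D3; rewrite (sgdistC S z) in D1.
(* Each of the [r0] separating lines contributes 2, and [p] and [q], each through only one of the
   two crossings, contribute 1 each. With [D1], [D2], [D3], [dp] and [dq] this yields [r0 <= r1]. *)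
have D4 : (r0.*2 + 2 <= sgdist S (X p x) (X q x))%N.
  have one c : c \in S -> (1 <= \sum_(d <- S) (d == c))%N.
    by move=> cS; rewrite (big_rem c) //= eqxx leq_addr.
  have := leq_add (one p pS) (one q qS).
  have -> : r0.*2 = (\sum_(c <- S) (sep c (X p x) (X q x)).*2)%N.
    rewrite /r0 /nsep -sum1_count big_mkcond -mul2n big_distrr /=.
    by apply: eq_bigr => c _; case: sep.
  rewrite -(leq_add2l (\sum_(c <- S) (sep c (X p x) (X q x)).*2)) => /leq_trans; apply.
  rewrite -!big_split /sgdist !big_seq; apply: leq_sum => c cS.
  have [->|cp] := eqVneq c p.
    rewrite (negbTE pq) {1}/sep cX // eqxx /=.
    have : sg p (X q x) <> 0.
      by apply: (sgX_neq0 sgS); [rewrite eq_sym ne|rewrite eq_sym|exact: ne].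
    by case: (sgP p (X q x)) => ->.
  have [->|cq] := eqVneq c q.
    rewrite sepC {1}/sep cX //=.
    have : sg q (X p x) <> 0.
      by apply: (sgX_neq0 sgS); [rewrite eq_sym ne| |exact: ne].
    by case: (sgP q (X p x)) => ->.
  by rewrite /sep /=; case: (sgP c (X p x)) => ->; case: (sgP c (X q x)) => ->.
have := walk_cat W0 (WalkS aL (walk_cat W4 (WalkS (adj_sym bL) (walk_sym W2)))).
by apply: walk_le; lia.
Qed.

Lemma walk_cat_lines S T N u v : uniq (T ++ S) ->
  walk S N u v -> walk (T ++ S) (size T + N) u v.
Proof.
elim: T => [|x T IHT] //= u1 w; rewrite addSn.
by apply: walk_add_line => //; apply: IHT => //; case/andP: u1.
Qed.

Lemma walk_eq_mem S T N u v : S =i T -> walk S N u v -> walk T N u v.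
Proof.
move=> ST.
have vc w : vtx S w -> vtx T w.
  by move=> [i [j [iS jS ij iw jw]]]; exists i, j; rewrite -!ST.
elim=> [{}N {}u|{}N {}u y {}v [vx vy xy [k kS ?] h] _]; first exact: Walk0.
apply: WalkS; split=> //; [exact: vc|exact: vc| |].
  by exists k => //; rewrite -ST.
by move=> c; rewrite -ST => /h.
Qed.

Lemma walk_full S N u v : uniq S -> walk S N u v ->
  walk (enum I) (N + (#|I| - size S)) u v.
Proof.
move=> uS w; pose T := [seq x <- enum I | x \notin S].
have uTS : uniq (T ++ S).
  rewrite cat_uniq filter_uniq ?enum_uniq // uS andbT.
  by apply/hasPn => x xS; rewrite mem_filter xS.
have mTS : T ++ S =i enum I.
  by move=> x; rewrite mem_cat mem_filter mem_enum; case: (x \in S).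
apply: (walk_eq_mem mTS); apply: walk_le (walk_cat_lines uTS w).
have /perm_size : perm_eq (T ++ S) (enum I).
  exact: uniq_perm uTS (enum_uniq _) mTS.
by rewrite size_cat -cardE => <-; rewrite addnK addnC.
Qed.
End Walks.

Ltac neq := solve [assumption | rewrite eq_sym; assumption].

(** * The cells at a vertex *)

(* [u] is on an unbounded cell that reaches the end [b] of [k]. *)
Definition exterior (I : finType) (P : Type) (sg : I -> P -> int)
    (e : I -> bool -> P) u :=
  exists k b, forall m, sg m u <> 0 -> m != k -> sg m u = sg m (e k b).

Section Corner.
Variables (I : finType) (P : eqType) (sg : I -> P -> int).
Variables (X : I -> I -> P) (e : I -> bool -> P).
Hypothesis sgS : sign_system sg X e.

Let sgP := sgP sgS.
Let ray := ray sgS.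
Let XC := XC sgS.
Let sgX := sgX sgS.
Let sgXr := sgXr sgS.
Let sgX_neq0 := sgX_neq0 sgS.

(* A line through a point of a quadrant of [i] and [j] leaves it through one of
   the two bounding rays. *)
Lemma quadrant i j c p : i != j -> c != i -> c != j -> sg c p = 0 ->
  sg i p = sg i (X c j) \/ sg j p = sg j (X c i).
Proof.
move=> ij ci cj cp; have [->|/eqP ip] := eqVneq (sg i p) (sg i (X c j)).
  by left.
right; apply: (ray (i := i) (k := c)) => //; try neq.
  by rewrite sgX.
by rewrite sgXr // => /esym; apply: sgX_neq0; neq.
Qed.

Lemma exists_end k c s : c != k -> s = 1 \/ s = -1 -> exists b, sg c (e k b) = s.
Proof.
move=> ck h; have := sg_end_neq0 sgS (b := true) ck.
have := sg_end_opp sgS c k true; rewrite /=.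
case: (sgP c (e k true)) => t // o _; case: h => ->.
- by exists false; rewrite o t.
- by exists true.
- by exists true.
- by exists false; rewrite o t.
Qed.

(* The corner is on the positive side of all other lines. *)
Definition corner i j := i != j /\
  forall m, m != i -> m != j -> sg m (X i j) = 1.

Lemma cornerC i j : corner i j -> corner j i.
Proof. by case=> ij h; split=> [|m mj mi]; [rewrite eq_sym|rewrite XC h]. Qed.

(** On [i], the line [j] weakly separates both [p] and the corner from the crossing with [m], so
    [ray] puts them on the same side of [m]. *)
Lemma on_side i j m p : corner i j -> m != i -> m != j ->
  sg i p = 0 -> sg j p <> sg j (X i m) -> sg m p = 1.
Proof.
case=> ij h mi mj ip jp; rewrite -(h m mi mj).
apply: (ray (i := j) (k := i)) => //; try neq; first exact: sgX.
by rewrite sgXr // => /esym; apply: sgX_neq0; neq.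
Qed.

Lemma on_end i j m b : corner i j -> m != i -> m != j ->
  sg j (e i b) = sg j (X i m) -> sg m (e i b) = -1.
Proof.
move=> h mi mj jb; have [ij _] := h; have ji : j != i by neq.
have := sg_end_opp sgS m i b.
have -> : sg m (e i (~~ b)) = 1.
  apply: (on_side h) => //; first exact: (sg_end sgS).
  rewrite (sg_end_opp sgS) jb; have : sg j (X i m) <> 0 by apply: sgX_neq0; neq.
  by case: (sgP j (X i m)) => ->.
lia.
Qed.

(** Of the two crossings on the negative half of [i], the one nearer to the corner is on the
    positive side of the other line. The sign at [X i a] is found by comparison with the negative
    end of [i] or with the corner, according to the sign at [X i b]. *)
Lemma crossing_order i j a b : corner i j -> a != b ->
  a != i -> a != j -> b != i -> b != j ->
  sg j (X i a) = -1 -> sg j (X i b) = -1 ->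
  sg b (X i a) = - sg a (X i b).
Proof.
move=> h ab ai aj bi bj ja jb; have [ij hu] := h; have ji : j != i by neq.
have [b0 eb] := exists_end ji (or_intror (erefl (-1 : int))).
have ea := on_end h ai aj (etrans eb (esym ja)).
have eb' := on_end h bi bj (etrans eb (esym jb)).
have ba0 : sg b (X i a) <> 0 by apply: sgX_neq0; neq.
have ab0 : sg a (X i b) <> 0 by apply: sgX_neq0; neq.
have aa : sg a (X i a) = 0 by apply: sgXr; neq.
have ia : sg i (X i a) = 0 by apply: sgX; neq.
have iu : sg i (X i j) = 0 by apply: sgX; neq.
have := ray ab ai bi (sg_end sgS i b0) ia; rewrite ea eb' aa.
have := ray ab ai bi iu ia; rewrite hu // (hu b) // aa.
case: (sgP a (X i b)) ab0 => -> //; case: (sgP b (X i a)) ba0 => -> // _ _.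
  by lia.
by lia.
Qed.

(** * Unbounded cells in the negative quadrant of a corner *)

Section Innermost.
Variables i j : I.
Hypothesis hu : corner i j.

Let ij : i != j. Proof. by case: hu. Qed.

(** The Boolean selects the end of [m] on the negative side of [i]; see [far_neg]. *)
Definition far m := e m (sg i (e m true) == -1).

(* Coming from the positive half of [j], [m] crosses the negative half of [i] and
   then runs to infinity in the quadrant where [i] and [j] are negative. *)
Definition inner_line m :=
  [&& m != i, m != j, sg j (X i m) == -1 & sg i (X j m) == 1].

Lemma sg_far m : sg m (far m) = 0.
Proof. exact: (sg_end sgS). Qed.

Lemma far_neg m : m != i -> sg i (far m) = -1.
Proof.
move=> mi; have im : i != m by neq.
have := sg_end_neq0 sgS (b := true) im; have := sg_end_opp sgS i m true.
by rewrite /far; case: (sgP i (e m true)) => h; rewrite h /= ?h.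
Qed.

Lemma far_flip a b : a != i -> b != i -> a != b ->
  sg i (X a b) = -1 -> sg b (far a) = - sg b (X a i).
Proof.
move=> ai bi ab iab; have := far_neg ai; rewrite /far.
set t := _ == _ => it; have := sg_end_opp sgS b a t.
have -> : sg b (e a (~~ t)) = sg b (X a i).
  apply: (ray (i := i) (k := a)); try neq; try exact: (sg_end sgS).
  - by apply: sgX; neq.
  - by rewrite (sg_end_opp sgS) it iab.
  - by rewrite sgXr ?iab.
by move=> ->; rewrite opprK.
Qed.

Lemma far_same a b : a != i -> b != i -> a != b ->
  sg i (X a b) = 1 -> sg b (far a) = sg b (X a i).
Proof.
move=> ai bi ab iab; apply: (ray (i := i) (k := a)); try neq.
- exact: sg_far.
- by apply: sgX; neq.
- by rewrite far_neg // iab.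
- by rewrite sgXr ?iab.
Qed.

(** On its way from [i] to its far end, [a] changes its side of [b] exactly when their crossing lies
    on the negative side of [i]. *)
Lemma far_mul a b : a != i -> b != i -> a != b ->
  sg b (far a) = sg i (X a b) * sg b (X a i).
Proof.
move=> ai bi ab; have : sg i (X a b) <> 0 by apply: sgX_neq0.
case: (sgP i (X a b)) => // s _; rewrite s.
  by rewrite far_flip // mulN1r.
by rewrite far_same // mul1r.
Qed.

(** In [far_mul] the first factor is symmetric in the two lines, and the second is antisymmetric by
    [crossing_order]. *)
Lemma far_anti a b : inner_line a -> inner_line b -> a != b ->
  sg b (far a) = - sg a (far b).
Proof.
move=> /and4P[ai aj /eqP ja _] /and4P[bi bj /eqP jb _] ab.
rewrite !far_mul //; last neq.
by rewrite (XC b a) (XC a i) (XC b i) (crossing_order hu ab) // mulrN.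
Qed.

(* Inner lines are linearly ordered by their ends in the negative quadrant; the
   end of the first one bounds an unbounded cell at the corner. *)
Lemma far_acyclic_aux a b c : inner_line a -> inner_line b -> inner_line c ->
  a != b -> b != c -> c != a ->
  sg b (far a) = 1 -> sg c (far b) = 1 -> sg a (far c) = 1 ->
  sg b (X i a) <> sg c (X i b).
Proof.
move=> Ma Mb Mc ab bc ca fab fbc fca.
have fba : sg a (far b) = -1 by rewrite -(opprK (sg a _)) -(far_anti Ma Mb ab) fab.
have fcb : sg b (far c) = -1 by rewrite -(opprK (sg b _)) -(far_anti Mb Mc bc) fbc.
have fac : sg c (far a) = -1 by rewrite -(opprK (sg c _)) -(far_anti Mc Ma ca) fca.
have [/and4P[ai aj /eqP ja _] /and4P[bi bj /eqP jb _]] := (Ma, Mb).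
have /and4P[ci cj /eqP jc _] := Mc.
have ac : a != c by neq. have cb : c != b by neq. have ba : b != a by neq.
have oab := crossing_order hu ab ai aj bi bj ja jb.
have obc := crossing_order hu bc bi bj ci cj jb jc.
have oca := crossing_order hu ca ci cj ai aj jc ja.
have iX m : m != i -> sg i (X i m) = 0 by move=> mi; apply: sgX; neq.
have mX m : m != i -> sg m (X i m) = 0 by move=> mi; apply: sgXr; neq.
have ba0 : sg b (X i a) <> 0 by apply: sgX_neq0; neq.
have cb0 : sg c (X i b) <> 0 by apply: sgX_neq0; neq.
have ac0 : sg a (X i c) <> 0 by apply: sgX_neq0; neq.
have := ray ac ai ci (iX b bi) (iX a ai); rewrite mX //.
(* Suppose the first two signs agree. If the third agrees as well, the crossings with [i] are in
   cyclic order, against [h]. Otherwise some of the lines must cross on the way to their far ends,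
   and [btw] gives such a crossing two incompatible sides. *)
case: (sgP b (X i a)) ba0 => p // _; rewrite p in oab *;
  case: (sgP c (X i b)) cb0 => q // _; rewrite q in obc * => //;
  case: (sgP a (X i c)) ac0 => r // _; rewrite r in oca * => h _.
- have E1 : sg a (X i b) = 1 by clear -oab; lia.
  have E2 : sg c (X i a) = 1 by clear -oca; lia.
  by rewrite E1 E2 in h; clear -h; lia.
- have sc : sep sg b (X i c) (far c) by rewrite /sep fcb; clear -obc q; lia.
  have ya : sg a (X c b) = 1.
    by case: (btw sgS (mX c ci) (sg_far c) sc ac ab) => ->.
  have : sg c (far b) = sg c (X b a).
    apply: (ray (i := a) (k := b)) => //; [exact: sg_far|exact: sgX| |].
      by rewrite fba XC ya.
    by rewrite sgXr // XC ya.
  have sa : sep sg b (X i a) (far a) by rewrite /sep p fab.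
  rewrite fbc XC.
  by case: (btw sgS (mX a ai) (sg_far a) sa ca cb) => ->; clear -fac oca; lia.
- have sa : sep sg c (X i a) (far a) by rewrite /sep fac; clear -oca; lia.
  have sc : sep sg a (X i c) (far c) by rewrite /sep fca r.
  have := btw sgS (mX a ai) (sg_far a) sa ba bc.
  have := btw sgS (mX c ci) (sg_far c) sc bc ba.
  by rewrite (XC c a) p fab fcb; clear -obc; lia.
- have E1 : sg a (X i b) = -1 by clear -oab; lia.
  have E2 : sg c (X i a) = -1 by clear -oca; lia.
  by rewrite E1 E2 in h; clear -h; lia.
Qed.

(** For the three rotations of the cycle, [far_acyclic_aux] makes three signs pairwise distinct, but
    they take only two values. *)
Lemma far_acyclic a b c : inner_line a -> inner_line b -> inner_line c ->
  a != b -> b != c -> c != a ->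
  sg b (far a) = 1 -> sg c (far b) = 1 -> sg a (far c) = 1 -> False.
Proof.
move=> Ma Mb Mc ab bc ca fab fbc fca.
have h1 := far_acyclic_aux Ma Mb Mc ab bc ca fab fbc fca.
have h2 := far_acyclic_aux Mb Mc Ma bc ca ab fbc fca fab.
have h3 := far_acyclic_aux Mc Ma Mb ca ab bc fca fab fbc.
have [/and4P[ai _ _ _] /and4P[bi _ _ _] /and4P[ci _ _ _]] := And3 Ma Mb Mc.
have ba0 : sg b (X i a) <> 0 by apply: sgX_neq0; neq.
have cb0 : sg c (X i b) <> 0 by apply: sgX_neq0; neq.
have ac0 : sg a (X i c) <> 0 by apply: sgX_neq0; neq.
case: (sgP b (X i a)) ba0 h1 h3 => -> // _; case: (sgP c (X i b)) cb0 h2 => -> // _;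
  by case: (sgP a (X i c)) ac0 => -> // _ a1 a2 a3;
    first [case: a1|case: a2|case: a3].
Qed.

(** The sides of the far ends form a tournament by [far_anti], transitive by [far_acyclic]. The
    induction on [s] keeps its first element. *)
Lemma innermost s m0 : inner_line m0 -> all inner_line s ->
  exists2 m, inner_line m &
    forall c, c \in m0 :: s -> c != m -> sg c (far m) = 1.
Proof.
move=> M0; elim: s => [_|c s IHs /= /andP[Mc Ms]].
  by exists m0 => // c; rewrite inE => ->.
have [m Mm h] := IHs Ms.
have [cm|cm] := eqVneq c m.
  by exists m => // d; rewrite !inE cm => /or3P[dm|/eqP ->|ds] dm';
    [apply: h|rewrite eqxx in dm'|apply: h] => //; rewrite !inE ?dm ?ds ?orbT.
have [/and4P[ci _ _ _] /and4P[mi _ _ _]] := (Mc, Mm).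
have := sg_end_neq0 sgS (b := sg i (e m true) == -1) cm; rewrite -/(far m).
case: (sgP c (far m)) => fmc // _.
- exists c => // d dS dc; have [->|dm] := eqVneq d m.
    by have := far_anti Mm Mc ltac:(neq); rewrite fmc => /oppr_inj <-.
  have dS' : d \in m0 :: s by move: dS; rewrite !inE (negbTE dc).
  have fmd := h d dS' dm.
  have Md : inner_line d.
    by move: dS'; rewrite inE => /predU1P[->|] //; apply/allP.
  have fcm : sg m (far c) = 1.
    by have := far_anti Mm Mc ltac:(neq); rewrite fmc => /oppr_inj <-.
  have := far_anti Md Mc dc.
  have [/and4P[di _ _ _]] := Md.
  have fdc := far_acyclic Mm Md Mc ltac:(neq) dc cm fmd.
  have fcd0 : sg d (far c) <> 0 by apply: (sg_end_neq0 sgS).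
  case: (sgP d (far c)) fcd0 => // fcd _ E.
  by case: fdc => //; rewrite E fcd.
- exists m => // d; rewrite !inE => /or3P[dm|/eqP ->|ds] // dm'.
    by apply: h => //; rewrite inE dm.
  by apply: h => //; rewrite inE ds orbT.
Qed.

(* The two ways to cut off the cell at the corner in the negative quadrant from
   infinity: by one line, or by two lines crossing in that quadrant. *)
Definition blocked1 m :=
  [&& m != i, m != j, sg j (X i m) == -1 & sg i (X j m) == -1].

Definition blocked2 m m' :=
  [&& inner_line m, m' != i, m' != j, sg j (X i m') == 1, sg i (X j m') == -1,
      sg i (X m m') == -1 & sg j (X m m') == -1].

(** By contraposition, with an explicit end: that of [i] on the negative side of [j] if there is no
    inner line, and otherwise the far end of the first inner line. *)
Lemma not_exterior_blocked : ~ exterior sg e (X i j) ->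
  [exists m, blocked1 m] || [exists m, exists m', blocked2 m m'].
Proof.
move=> nE; apply/negPn/negP; rewrite negb_or => /andP[nA nB]; apply: nE.
have ji : j != i by neq.
have A m : blocked1 m -> False.
  by move=> b; move/negP: nA; apply; apply/existsP; exists m.
have B m m' : blocked2 m m' -> False.
  by move=> b; move/negP: nB; apply; apply/existsP; exists m; apply/existsP; exists m'.
have hu1 m : sg m (X i j) <> 0 -> [/\ m != i, m != j & sg m (X i j) = 1].
  move=> m0; have mi : m != i by apply: contra_notN m0 => /eqP ->; exact: sgX.
  have mj : m != j by apply: contra_notN m0 => /eqP ->; exact: sgXr.
  by split=> //; case: hu => _; apply.
have jX0 m : m != i -> m != j -> sg j (X i m) <> 0 by move=> *; apply: sgX_neq0; neq.
have iX0 m : m != i -> m != j -> sg i (X j m) <> 0 by move=> *; apply: sgX_neq0; neq.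
have [/existsP[m0 Mm0]|/existsPn nM] := boolP [exists m, inner_line m]; last first.
  have [b eb] := exists_end ji (or_intror (erefl (-1 : int))).
  exists i, b => m /hu1[mi mj ->] _; symmetry.
  apply: (on_side hu) => //; first exact: (sg_end sgS).
  rewrite eb => jm; have := nM m; have := A m.
  rewrite /blocked1 /inner_line mi mj -jm eqxx /=.
  by case: (sgP i (X j m)) (iX0 m mi mj) => -> //= _ H; case: H.
have [m Mm h] := innermost Mm0 (filter_all inner_line (enum I)).
have /and4P[mi mj /eqP jm /eqP im] := Mm.
exists m, (sg i (e m true) == -1) => c /hu1[ci cj ->] cm; symmetry.
rewrite -/(far m); have [Mc|nMc] := boolP (inner_line c).
  by apply: h => //; rewrite inE mem_filter Mc mem_enum orbT.
have jc : sg j (X i c) = 1.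
  move: nMc (A c) (jX0 c ci cj) (iX0 c ci cj); rewrite /inner_line /blocked1 ci cj /=.
  by case: (sgP j (X i c)) => ->; case: (sgP i (X j c)) => -> //= _ H; case: H.
have xc : sg c (X i m) = 1.
  by apply: (on_side hu) => //; [apply: sgX; neq|rewrite jm jc].
have fj : sg j (far m) = -1.
  rewrite -jm (XC i m); apply: (ray (i := i) (k := m)) => //; try neq.
  - exact: sg_far.
  - exact: sgX.
  - by rewrite far_neg // (XC m j) im.
  - by rewrite sgXr // (XC m j) im.
have fmc0 : sg c (far m) <> 0 by apply: (sg_end_neq0 sgS).
(* If the far end of [m] were on the negative side of [c], then [c] would cross [m] inside the
   negative quadrant. By [quadrant] it would also cross the negative half of [j], so [m] and [c]
   would block the quadrant. *)
case: (sgP c (far m)) fmc0 => // fc _; exfalso.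
have s : sep sg c (X i m) (far m) by rewrite /sep xc fc.
have mX : sg m (X i m) = 0 by apply: sgXr; neq.
have iX : sg i (X i m) = 0 by apply: sgX; neq.
have mc : m != c by neq.
have cX : sg c (X m c) = 0 by apply: sgXr.
have im0 : sg i (X m c) <> 0 by apply: sgX_neq0.
have Yi : sg i (X m c) = -1.
  have := btw sgS mX (sg_far m) s (c' := i); rewrite iX far_neg //.
  by case=> //; neq.
have Yj : sg j (X m c) = -1.
  have := btw sgS mX (sg_far m) s (c' := j); rewrite jm fj.
  by case=> //; neq.
have [ic|ic] : sg i (X j c) = 1 \/ sg i (X j c) = -1.
  by case: (sgP i (X j c)) (iX0 c ci cj); [right| |left].
- have := quadrant ij ci cj cX.
  by rewrite Yi Yj (XC c j) (XC c i) ic jc => -[].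
- by apply: (B m c); rewrite /blocked2 Mm ci cj jc ic Yi Yj.
Qed.
End Innermost.
End Corner.

(** * Short walks in subarrangements of four to six lines *)

Section Shortcuts.
Variables (I : finType) (P : eqType) (sg : I -> P -> int).
Variables (X : I -> I -> P) (e : I -> bool -> P).
Hypothesis sgS : sign_system sg X e.

Let sgP := sgP sgS.
Let ray := ray sgS.
Let XC := XC sgS.
Let sgX := sgX sgS.
Let sgXr := sgXr sgS.
Let sgX_neq0 := sgX_neq0 sgS.

(* By [walk_full] this gives at most [#|I| - 3] edges in the whole arrangement. *)
Definition shortcut u v :=
  exists S N, [/\ uniq S, walk sg S N u v & (N + 3 <= size S)%N].

(* The ray of [i] from [X i j] to the positive side of [j] meets [k], and does so
   before [l]. *)
Definition first_hit i j k l := sg j (X i k) = 1 /\ sg l (X i k) = 1.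

(** Either [l] misses the segment of [i] from the corner to [X i k], or its crossing lies on that
    segment and [btw] gives both signs there. *)
Lemma first_hit_or i j k l : corner sg X i j ->
  k != i -> k != j -> l != i -> l != j -> k != l -> sg j (X i k) = 1 ->
  first_hit i j k l \/ first_hit i j l k.
Proof.
move=> hu ki kj li lj kl jk; have [ij h] := hu.
have : sg l (X i k) <> 0 by apply: sgX_neq0; neq.
case: (sgP l (X i k)) => lk // _; last by left.
have iu : sg i (X i j) = 0 by apply: sgX.
have ix : sg i (X i k) = 0 by apply: sgX; neq.
have s : sep sg l (X i j) (X i k) by rewrite /sep lk h.
right; split.
- have : sg j (X i l) <> 0 by apply: sgX_neq0; neq.
  have := btw sgS iu ix s (c' := j); rewrite sgXr // jk => /(_ ltac:(neq) ltac:(neq)).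
  by case=> ->.
- have : sg k (X i l) <> 0 by apply: sgX_neq0; neq.
  have := btw sgS iu ix s (c' := k); rewrite sgXr 1?eq_sym // (h k) //.
  by move=> /(_ ltac:(neq) ltac:(neq)); case=> ->.
Qed.

Section Quadrilateral.
Variables (i j k l : I) (v : P).
Hypotheses (hu : corner sg X i j) (ki : k != i) (kj : k != j).
Hypotheses (li : l != i) (lj : l != j) (kl : k != l).
Hypotheses (kv : sg k v = 0) (lv : sg l v = 0).
Hypotheses (iv : sg i v = 1) (jv : sg j v = 1).

Let ij : i != j. Proof. by case: hu. Qed.

Lemma first_hit_exists : [\/ first_hit i j k l, first_hit i j l k,
  first_hit j i k l | first_hit j i l k].
Proof.
have := quadrant sgS ij ki kj kv; rewrite iv jv (XC k) (XC k i).
case=> /esym h.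
  by case: (first_hit_or (cornerC sgS hu) kj ki lj li kl h);
    [constructor 3|constructor 4].
by case: (first_hit_or hu ki kj li lj kl h); [constructor 1|constructor 2].
Qed.

Lemma sgv_neq0 c : c != k -> c != l -> sg c v <> 0.
Proof. by move=> ck cl; apply: (on3 sgS kl) kv lv; neq. Qed.

Section First.
Hypothesis hx : first_hit i j k l.
Let u := X i j.
Let x := X i k.

Let iu : sg i u = 0. Proof. exact: sgX. Qed.
Let ju : sg j u = 0. Proof. exact: sgXr. Qed.
Let cu c : c != i -> c != j -> sg c u = 1. Proof. by case: hu => _; apply. Qed.
Let ix : sg i x = 0. Proof. by apply: sgX; neq. Qed.
Let kx : sg k x = 0. Proof. by apply: sgXr; neq. Qed.
Let jx : sg j x = 1. Proof. by case: hx. Qed.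
Let lx : sg l x = 1. Proof. by case: hx. Qed.

(** The walk follows [i] up to [k] and then [k] up to [v]. Its length is controlled by counting the
    lines of [S] that cut either leg; none of [i], [j], [k], [l] does. *)
Lemma two_legs S : i \in S -> j \in S -> k \in S -> l \in S ->
  walk sg S ((nsep sg S u x).+1 + (nsep sg S x v).+1) u v.
Proof.
move=> iS jS kS lS; have vx : vtx sg S x by apply: (vtxX sgS); neq.
apply: walk_cat (straight sgS iS _ vx iu ix) (straight sgS kS vx _ kx kv).
  exact: (vtxX sgS).
by exists k, l.
Qed.

Lemma walk_quadrilateral : walk sg [:: i; j; k; l] 2 u v.
Proof.
have := two_legs (S := [:: i; j; k; l]); rewrite !inE !eqxx !orbT.
move=> /(_ isT isT isT isT).
by rewrite /nsep /= /sep ix iu ju kx !cu // iv jx jv kv lx lv.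
Qed.

Lemma crossing_kx m : m != i -> m != j -> m != k -> m != l ->
  sep sg m x v ->
  [/\ sg i (X k m) = 1, sg j (X k m) = 1 & sg l (X k m) = 1].
Proof.
move=> mi mj mk ml s.
have y0 c : c != k -> c != m -> sg c (X k m) <> 0.
  by move=> ck cm; apply: sgX_neq0; neq.
split.
- have : sg i (X k m) <> 0 by apply: y0; neq.
  by case: (btw sgS kx kv s (c' := i)) => [||->|->]; try neq; rewrite ?ix ?iv.
- by case: (btw sgS kx kv s (c' := j)) => [||->|->]; try neq; rewrite ?jx ?jv.
- have : sg l (X k m) <> 0 by apply: y0; neq.
  by case: (btw sgS kx kv s (c' := l)) => [||->|->]; try neq; rewrite ?lx ?lv.
Qed.

(** A line meeting [i] and [j] in their negative halves misses the positive quadrant. Hence [m] cuts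
    neither leg, and two edges suffice among five lines. *)
Lemma shortcut_blocked1 m : blocked1 sg X i j m -> shortcut u v.
Proof.
move=> /and4P[mi mj /eqP jm /eqP im].
have no y : sg m y = 0 -> sg i y = 1 -> sg j y = 1 -> False.
  move=> my iy jy; have := quadrant sgS ij mi mj my.
  by rewrite iy jy (XC m) (XC m) im jm => -[].
have mk : m != k by apply/eqP => E; apply: (no v) => //; rewrite E.
have ml : m != l by apply/eqP => E; apply: (no v) => //; rewrite E.
have mx : sg m x = 1 by apply: (on_side sgS hu) => //; rewrite jx jm.
have mv : sg m v = 1.
  have := sgv_neq0 mk ml; case: (sgP m v) => // mv _; exfalso.
  have [iy jy _] : [/\ sg i (X k m) = 1, sg j (X k m) = 1 & sg l (X k m) = 1].
    by apply: crossing_kx => //; rewrite /sep mx mv.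
  by apply: (no (X k m)) => //; apply: sgXr; neq.
exists [:: i; j; k; l; m], 2; split=> //.
  rewrite /= !inE !negb_or ij kl (eq_sym i k) ki (eq_sym i l) li (eq_sym i m) mi.
  by rewrite (eq_sym j k) kj (eq_sym j l) lj (eq_sym j m) mj (eq_sym k m) mk
    (eq_sym l m) ml.
have := two_legs (S := [:: i; j; k; l; m]); rewrite !inE !eqxx !orbT.
move=> /(_ isT isT isT isT).
by rewrite /nsep /= /sep ix iu ju kx !cu // iv jx jv kv lx lv mx mv.
Qed.

End First.
End Quadrilateral.

Section Blocked2.
Variables (i j m m' : I).
Hypotheses (hu : corner sg X i j) (hb : blocked2 sg X i j m m').

Let ij : i != j. Proof. by case: hu. Qed.
Let mi : m != i. Proof. by case/and5P: hb => /and4P[]. Qed.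
Let mj : m != j. Proof. by case/and5P: hb => /and4P[]. Qed.
Let jm : sg j (X i m) = -1. Proof. by case/and5P: hb => /and4P[_ _ /eqP]. Qed.
Let im : sg i (X j m) = 1. Proof. by case/and5P: hb => /and4P[_ _ _ /eqP]. Qed.
Let mi' : m' != i. Proof. by case/and5P: hb. Qed.
Let mj' : m' != j. Proof. by case/and5P: hb. Qed.
Let jm' : sg j (X i m') = 1. Proof. by case/and5P: hb => _ _ _ /eqP. Qed.
Let im' : sg i (X j m') = -1.
Proof. by case/and5P: hb => _ _ _ _ /and3P[/eqP]. Qed.
Let imm : sg i (X m m') = -1.
Proof. by case/and5P: hb => _ _ _ _ /and3P[_ /eqP]. Qed.
Let jmm : sg j (X m m') = -1.
Proof. by case/and5P: hb => _ _ _ _ /and3P[_ _ /eqP]. Qed.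
Let mm : m != m'. Proof. by apply/eqP => E; have := jm; rewrite E jm'. Qed.

Lemma blocked2C : blocked2 sg X j i m' m.
Proof.
rewrite /blocked2 /inner_line mi mj mi' mj' im im' jm jm' (XC m') imm jmm.
by rewrite !eqxx.
Qed.

(** The crossing of [m] with [m'] is on the negative side of [i], so the points of [m] not on that
    side, [X j m] among them, are all on one side of [m']. *)
Lemma blocked2_side p : sg m p = 0 -> sg i p <> -1 -> sg m' p = 1.
Proof.
move=> mp ip.
have <- : sg m' (X j m) = 1.
  apply: (on_side sgS (cornerC sgS hu)); rewrite ?im ?im' //.
  by apply: sgX; neq.
apply: (ray (i := i) (k := m)); try neq.
- by apply: sgXr; neq.
- by rewrite imm.
- by rewrite im imm.
Qed.
End Blocked2.

Section Blocked2Shortcuts.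
Variables (i j k l m m' : I) (v : P).
Hypotheses (hu : corner sg X i j) (ki : k != i) (kj : k != j).
Hypotheses (li : l != i) (lj : l != j) (kl : k != l).
Hypotheses (kv : sg k v = 0) (lv : sg l v = 0).
Hypotheses (iv : sg i v = 1) (jv : sg j v = 1).
Hypothesis hb : blocked2 sg X i j m m'.

Let ij : i != j. Proof. by case: hu. Qed.
Let mi : m != i. Proof. by case/and5P: hb => /and4P[]. Qed.
Let mj : m != j. Proof. by case/and5P: hb => /and4P[]. Qed.
Let jm : sg j (X i m) = -1. Proof. by case/and5P: hb => /and4P[_ _ /eqP]. Qed.
Let im : sg i (X j m) = 1. Proof. by case/and5P: hb => /and4P[_ _ _ /eqP]. Qed.
Let mi' : m' != i. Proof. by case/and5P: hb. Qed.
Let mj' : m' != j. Proof. by case/and5P: hb. Qed.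
Let jm' : sg j (X i m') = 1. Proof. by case/and5P: hb => _ _ _ /eqP. Qed.
Let im' : sg i (X j m') = -1.
Proof. by case/and5P: hb => _ _ _ _ /and3P[/eqP]. Qed.
Let imm : sg i (X m m') = -1.
Proof. by case/and5P: hb => _ _ _ _ /and3P[_ /eqP]. Qed.
Let jmm : sg j (X m m') = -1.
Proof. by case/and5P: hb => _ _ _ _ /and3P[_ _ /eqP]. Qed.
Let mm : m != m'. Proof. by apply/eqP => E; have := jm; rewrite E jm'. Qed.
Let u := X i j.
Let iu : sg i u = 0. Proof. exact: sgX. Qed.
Let ju : sg j u = 0. Proof. exact: sgXr. Qed.
Let cu c : c != i -> c != j -> sg c u = 1. Proof. by case: hu => _; apply. Qed.

(** Here [v] lies on a blocking line. The walk follows [j] to whichever of [k] and [m] it meets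
    first, and then that line to [v]: two edges among five lines. *)
Lemma shortcut_blocked2_on : l = m -> shortcut u v.
Proof.
move=> lm; have km : k != m by rewrite -lm.
have mv : sg m v = 0 by rewrite -lm.
have mv' : sg m' v = 1 by apply: (blocked2_side hu hb) => //; rewrite iv.
have km' : k != m' by apply: contraTneq isT => E; rewrite -E kv in mv'.
have side p : sg j p = 0 -> sg i p = 1 -> sg m' p = 1.
  move=> jp ip; apply: (on_side sgS (cornerC sgS hu)) => //; rewrite im'.
  by rewrite ip.
have jy : sg j (X j m) = 0 by apply: sgX; neq.
have my : sg m (X j m) = 0 by apply: sgXr; neq.
have : sg k (X j m) <> 0 by apply: sgX_neq0; neq.
have uS : uniq [:: i; j; k; m; m'].
  rewrite /= !inE !negb_or ij km km' mm (eq_sym i k) ki (eq_sym i m) mi.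
  by rewrite (eq_sym i m') mi' (eq_sym j k) kj (eq_sym j m) mj (eq_sym j m') mj'.
set S := [:: i; j; k; m; m'] in uS *.
have iS : i \in S by rewrite !inE eqxx.
have jS : j \in S by rewrite !inE eqxx !orbT.
have kS : k \in S by rewrite !inE eqxx !orbT.
have mS : m \in S by rewrite !inE eqxx !orbT.
have vu : vtx sg S u by apply: (vtxX sgS).
have vv : vtx sg S v by exists k, m.
case: (sgP k (X j m)) => ky // _; exists S, 2; split=> //.
  have s : sep sg k u (X j m) by rewrite /sep ky cu.
  have jz : sg j (X j k) = 0 by apply: sgX; neq.
  have kz : sg k (X j k) = 0 by apply: sgXr; neq.
  have iz : sg i (X j k) = 1.
    have : sg i (X j k) <> 0 by apply: sgX_neq0; neq.
    by case: (btw sgS ju jy s (c' := i)) => [||->|->]; try neq; rewrite ?iu ?im.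
  have mz : sg m (X j k) = 1.
    have : sg m (X j k) <> 0 by apply: sgX_neq0; neq.
    case: (btw sgS ju jy s (c' := m)) => [||->|->]; try neq; rewrite ?my //.
    by rewrite cu.
  have vz : vtx sg S (X j k) by apply: (vtxX sgS); neq.
  have := walk_cat (straight sgS jS vu vz ju jz) (straight sgS kS vz vv kz kv).
  rewrite /nsep /= /sep iu ju jz kz !cu // iz iv kv mv mz side //.
  by rewrite mv'.
have vy : vtx sg S (X j m) by apply: (vtxX sgS); neq.
have := walk_cat (straight sgS jS vu vy ju jy) (straight sgS mS vy vv my mv).
by rewrite /nsep /= /sep iu ju jy my !cu // ky kv im iv side // mv'.
Qed.

Hypotheses (mk : m != k) (ml : m != l) (mk' : m' != k) (ml' : m' != l).

(** Three edges are allowed among six lines, so the two legs suffice if [m] and [m'] cut them at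
    most once in total. Two sign patterns remain; they are settled by starting along [j], or by
    using [m] or [m'] as a middle leg. *)
Lemma shortcut_blocked2_off : first_hit i j k l -> shortcut u v.
Proof.
move=> hx; have [jx lx] := hx.
set S := [:: i; j; k; l; m; m'].
have uS : uniq S.
  rewrite /= !inE !negb_or ij kl mm (eq_sym i k) ki (eq_sym i m) mi.
  rewrite (eq_sym i m') mi' (eq_sym j k) kj (eq_sym j m) mj (eq_sym j m') mj'.
  rewrite (eq_sym i l) li (eq_sym j l) lj (eq_sym k m) mk (eq_sym k m') mk'.
  by rewrite (eq_sym l m) ml (eq_sym l m') ml'.
have [iS jS kS lS] : [/\ i \in S, j \in S, k \in S & l \in S].
  by rewrite !inE !eqxx !orbT.
have mS : m \in S by rewrite !inE eqxx !orbT.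
have mS' : m' \in S by rewrite !inE eqxx !orbT.
have vu : vtx sg S u by apply: (vtxX sgS).
have vv : vtx sg S v by exists k, l.
have side := blocked2_side hu hb.
have side' := blocked2_side (cornerC sgS hu) (blocked2C hb).
have ix : sg i (X i k) = 0 by apply: sgX; neq.
have kx : sg k (X i k) = 0 by apply: sgXr; neq.
have mx : sg m (X i k) = 1 by apply: (on_side sgS hu) => //; rewrite jx jm.
have mx' : sg m' (X i k) <> 0 by apply: sgX_neq0; neq.
have mv := sgv_neq0 kl kv lv mk ml.
have mv' := sgv_neq0 kl kv lv mk' ml'.
have K := crossing_kx ki kj kl kv lv iv jv hx.
(* Otherwise [k], running from [X i k] to [v], would cross first [m] and then [m']. The second
   crossing would be on the negative side of [m], against [side']. *)
have nn : ~ (sg m v = -1 /\ sg m' v = -1).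
  move=> [vm vm'].
  have [iy jy _] := K m mi mj mk ml ltac:(by rewrite /sep mx vm).
  have ky : sg k (X k m) = 0 by apply: sgX; neq.
  have my : sg m (X k m) = 0 by apply: sgXr; neq.
  have my' : sg m' (X k m) = 1 by apply: side => //; rewrite iy.
  have s : sep sg m' (X k m) v by rewrite /sep my' vm'.
  have jz : sg j (X k m') = 1.
    by case: (btw sgS ky kv s (c' := j)) => [||->|->] //; neq.
  have : sg m (X k m') = 1.
    by apply: side'; [apply: sgXr; neq|rewrite jz].
  by case: (btw sgS ky kv s (c' := m)) => [||->|->] //; rewrite ?my ?vm.
(* With a first leg along [j], the line [m'] cuts neither leg, and [m] cuts exactly one because [v]
   is on its negative side. *)
have across c d : c != i -> c != j -> d != i -> d != j -> c != d ->
    sg c v = 0 -> sg d v = 0 -> m != c -> m != d -> m' != c -> m' != d ->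
    sg m v = -1 -> sg m' v = 1 -> first_hit j i c d -> shortcut u v.
  move=> ci cj di dj cd cv dv mc md mc' md' vm vm' hc; have [ic dc] := hc.
  have u1 : uniq [:: j; i; c; d; m; m'].
    rewrite /= !inE !negb_or (eq_sym j i) ij cd mm (eq_sym i c) ci (eq_sym i m) mi.
    rewrite (eq_sym i m') mi' (eq_sym j c) cj (eq_sym j m) mj (eq_sym j m') mj'.
    rewrite (eq_sym i d) di (eq_sym j d) dj (eq_sym c m) mc (eq_sym c m') mc'.
    by rewrite (eq_sym d m) md (eq_sym d m') md'.
  have := two_legs (cornerC sgS hu) cj cd cv dv (S := [:: j; i; c; d; m; m']).
  rewrite !inE !eqxx !orbT => /(_ isT isT isT isT).
  have jw : sg j (X j c) = 0 by apply: sgX; neq.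
  have cw : sg c (X j c) = 0 by apply: sgXr; neq.
  have mw : sg m (X j c) <> 0 by apply: sgX_neq0; neq.
  have mw' : sg m' (X j c) = 1.
    by apply: (on_side sgS (cornerC sgS hu)); rewrite ?ic ?im'.
  rewrite (XC j i) -/u /nsep /= /sep iu ju jw cw !cu // ic iv jv cv dv dc mw' vm vm'.
  by case: (sgP m (X j c)) mw => // -> _ w; exists [:: j; i; c; d; m; m'], 3.
have := two_legs hu ki kl kv lv iS jS kS lS.
rewrite /nsep /= /sep iu ju ix kx !cu // jx iv jv kv lx lv mx.
case: (sgP m v) mv nn => // vm _; rewrite vm;
  case: (sgP m' v) mv' => // vm' _; rewrite vm' => nn;
  case: (sgP m' (X i k)) mx' => // xm _; rewrite xm;
  try by [case: nn | move=> w; exists S, 3; split=> //; apply: walk_le w].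
(* Here [m] cuts the second leg and [m'] cuts both. If [k] or [l] meets the positive half of [j],
   [across] applies; otherwise the walk follows [j], [m] and [k]. *)
- move=> _; have ky : sg k (X k m) = 0 by apply: sgX; neq.
  have my : sg m (X k m) = 0 by apply: sgXr; neq.
  have [iy jy ly] := K m mi mj mk ml ltac:(by rewrite /sep mx vm).
  have my' : sg m' (X k m) = 1 by apply: side => //; rewrite iy.
  have vy : vtx sg S (X k m) by apply: (vtxX sgS); neq.
  have jw : sg j (X j m) = 0 by apply: sgX; neq.
  have mw : sg m (X j m) = 0 by apply: sgXr; neq.
  have vw : vtx sg S (X j m) by apply: (vtxX sgS); neq.
  have mw' : sg m' (X j m) = 1 by apply: side => //; rewrite im.
  have jX0 c : c != i -> c != j -> sg i (X j c) <> 0.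
    by move=> ci cj; apply: sgX_neq0; neq.
  case: (sgP i (X j k)) (jX0 k ki kj) => // ik _; last first.
    case: (first_hit_or (cornerC sgS hu) kj ki lj li kl ik); apply: across => //; neq.
  case: (sgP i (X j l)) (jX0 l li lj) => // il _; last first.
    by case: (first_hit_or (cornerC sgS hu) lj li kj ki ltac:(neq) il);
      apply: across => //; neq.
  have kw : sg k (X j m) = 1.
    by apply: (on_side sgS (cornerC sgS hu)); rewrite ?im ?ik.
  have lw : sg l (X j m) = 1.
    by apply: (on_side sgS (cornerC sgS hu)); rewrite ?im ?il.
  exists S, 3; split=> //.
  have := walk_cat (straight sgS jS vu vw ju jw)
    (walk_cat (straight sgS mS vw vy mw my) (straight sgS kS vy vv ky kv)).
  rewrite /nsep /= /sep iu ju !cu // jw kw lw mw mw' im iy jy ky ly my my' iv.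
  by rewrite kv jv lv vm vm'.
(* Here only [m'] cuts the legs, each of them once. The walk follows [m'] from the first cut to the
   second. *)
- move=> _.
  have iy : sg i (X i m') = 0 by apply: sgX; neq.
  have my : sg m' (X i m') = 0 by apply: sgXr; neq.
  have s : sep sg m' u (X i k) by rewrite /sep xm cu.
  have ky : sg k (X i m') = 1.
    have : sg k (X i m') <> 0 by apply: sgX_neq0; neq.
    by case: (btw sgS iu ix s (c' := k)) => [||->|->]; rewrite ?kx ?cu //; neq.
  have ly : sg l (X i m') = 1.
    by case: (btw sgS iu ix s (c' := l)) => [||->|->]; rewrite ?lx ?cu //; neq.
  have my1 : sg m (X i m') = 1 by apply: side'; rewrite ?jm'.
  have vy : vtx sg S (X i m') by apply: (vtxX sgS); neq.
  have [iz jz lz] := K m' mi' mj' mk' ml' ltac:(by rewrite /sep xm vm').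
  have kz : sg k (X k m') = 0 by apply: sgX; neq.
  have mz : sg m' (X k m') = 0 by apply: sgXr; neq.
  have mz1 : sg m (X k m') = 1 by apply: side'; rewrite ?jz.
  have vz : vtx sg S (X k m') by apply: (vtxX sgS); neq.
  exists S, 3; split=> //.
  have := walk_cat (straight sgS iS vu vy iu iy)
    (walk_cat (straight sgS mS' vy vz my mz) (straight sgS kS vz vv kz kv)).
  rewrite /nsep /= /sep iu ju !cu // iy jm' ky ly my my1 iz jz lz kz mz mz1.
  by rewrite iv jv kv lv vm vm'.
Qed.
End Blocked2Shortcuts.
End Shortcuts.

(** * Eccentricities *)

Section Normalize.
Variables (I : finType) (P : eqType) (sg : I -> P -> int).
Variables (X : I -> I -> P) (e : I -> bool -> P).
Hypothesis sgS : sign_system sg X e.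
Variable s : I -> int.
Hypothesis sP : forall c, s c = 1 \/ s c = -1.

(** Lines carry no preferred orientation; reversing some of them brings any pair of vertices into
    the position required by [corner]. *)
Definition flip c p := s c * sg c p.

Lemma flip_inj c p q : flip c p = flip c q <-> sg c p = sg c q.
Proof. by rewrite /flip; split=> [|->//]; case: (sP c) => ->; lia. Qed.

Lemma flip_eq0 c p : flip c p = 0 <-> sg c p = 0.
Proof. by rewrite /flip; case: (sP c) => ->; lia. Qed.

Lemma sign_system_flip : sign_system flip X e.
Proof.
split.
- move=> c x; rewrite /flip; case: (sP c) => ->; case: (sgP sgS c x) => ->;
  by [constructor 1|constructor 2|constructor 3].
- exact: (XC sgS).
- by move=> i j ij; apply/flip_eq0; apply: (sgX sgS).
- by move=> i j x ij /flip_eq0 ix /flip_eq0; apply: (X_uniq sgS).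
- by move=> i j k ij ik jk /flip_eq0; apply: (sgX_neq0 sgS).
- move=> i m k p q im ik mk /flip_eq0 kp /flip_eq0 kq ip iq; apply/flip_inj.
  by apply: (ray sgS im ik mk kp kq) => /flip_inj.
- by move=> k b; apply/flip_eq0; apply: (sg_end sgS).
- by move=> c k b ck /flip_eq0; apply: (sg_end_neq0 sgS).
- by move=> c k b; rewrite /flip (sg_end_opp sgS) mulrN.
Qed.

Lemma sep_flip c x y : sep flip c x y = sep sg c x y.
Proof.
rewrite /sep /flip; case: (sP c) => ->; rewrite ?mul1r // !mulN1r.
by rewrite oppr_eq0 eqr_opp.
Qed.

Lemma vtx_flip S x : vtx flip S x -> vtx sg S x.
Proof.
by move=> [i [j [iS jS ij /flip_eq0 ix /flip_eq0 jx]]]; exists i, j.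
Qed.

Lemma walk_flip S N u v : walk flip S N u v -> walk sg S N u v.
Proof.
elim=> [{}N {}u|{}N {}u y {}v [vu vy uy [k kS [/flip_eq0 ku /flip_eq0 ky]] h] _ w].
  exact: Walk0.
apply: WalkS w; split=> //; [exact: vtx_flip|exact: vtx_flip|by exists k|].
by move=> c /h; rewrite sep_flip.
Qed.

Lemma shortcut_flip u v : shortcut flip u v -> shortcut sg u v.
Proof. by move=> [S [N [uS w SN]]]; exists S, N; split=> //; apply: walk_flip. Qed.

Lemma exterior_flip u : exterior flip e u -> exterior sg e u.
Proof.
move=> [k [b h]]; exists k, b => m mu mk; apply/flip_inj.
by apply: h => // /flip_eq0.
Qed.
End Normalize.

Section Eccentricity.
Variables (I : finType) (P : eqType) (sg : I -> P -> int).
Variables (X : I -> I -> P) (e : I -> bool -> P).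

Lemma shortcut_normalized i j k l v : sign_system sg X e -> corner sg X i j ->
  k != i -> k != j -> l != i -> l != j -> k != l ->
  sg k v = 0 -> sg l v = 0 -> sg i v = 1 -> sg j v = 1 ->
  ~ exterior sg e (X i j) -> shortcut sg (X i j) v.
Proof.
move=> sgS hu ki kj li lj kl kv lv iv jv /(not_exterior_blocked sgS hu).
have hu' := cornerC sgS hu; have lk : l != k by neq.
have fh := first_hit_exists sgS hu ki kj li lj kl kv iv jv.
case/orP => [/existsP[m b]|/existsP[m /existsP[m' b]]].
  have b' : blocked1 sg X j i m.
    by move: b; rewrite /blocked1 => /and4P[-> -> -> ->].
  case: fh => h.
  - exact: (shortcut_blocked1 sgS hu ki kj li lj kl kv lv iv jv h b).
  - exact: (shortcut_blocked1 sgS hu li lj ki kj lk lv kv iv jv h b).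
  - rewrite (XC sgS).
    exact: (shortcut_blocked1 sgS hu' kj ki lj li kl kv lv jv iv h b').
  - rewrite (XC sgS).
    exact: (shortcut_blocked1 sgS hu' lj li kj ki lk lv kv jv iv h b').
have b' := blocked2C sgS b.
have [lm|lm] := eqVneq l m.
  exact: (shortcut_blocked2_on sgS hu ki kj kl kv lv iv b lm).
have [km|km] := eqVneq k m.
  exact: (shortcut_blocked2_on sgS hu li lj lk lv kv iv b km).
have [lm'|lm'] := eqVneq l m'.
  rewrite (XC sgS).
  exact: (shortcut_blocked2_on sgS hu' kj ki kl kv lv jv b' lm').
have [km'|km'] := eqVneq k m'.
  rewrite (XC sgS).
  exact: (shortcut_blocked2_on sgS hu' lj li lk lv kv jv b' km').
rewrite eq_sym in lm; rewrite eq_sym in km.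
rewrite eq_sym in lm'; rewrite eq_sym in km'.
case: fh => h.
- exact: (shortcut_blocked2_off sgS hu ki kj li lj kl kv lv iv jv b km lm km' lm' h).
- exact: (shortcut_blocked2_off sgS hu li lj ki kj lk lv kv iv jv b lm km lm' km' h).
- rewrite (XC sgS).
  exact: (shortcut_blocked2_off sgS hu' kj ki lj li kl kv lv jv iv b' km' lm' km lm h).
- rewrite (XC sgS).
  exact: (shortcut_blocked2_off sgS hu' lj li kj ki lk lv kv jv iv b' lm' km' lm km h).
Qed.

Lemma walk2_normalized i j k l v : sign_system sg X e -> corner sg X i j ->
  k != i -> k != j -> l != i -> l != j -> k != l ->
  sg k v = 0 -> sg l v = 0 -> sg i v = 1 -> sg j v = 1 ->
  exists S, [/\ uniq S, walk sg S 2 (X i j) v & size S = 4].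
Proof.
move=> sgS hu ki kj li lj kl kv lv iv jv.
have hu' := cornerC sgS hu; have lk : l != k by neq.
have [ij _] := hu.
have ji : j != i by neq.
have uq a b c d : a != b -> c != a -> c != b -> d != a -> d != b -> c != d ->
    uniq [:: a; b; c; d].
  move=> ab ca cb da db cd.
  by rewrite /= !inE !negb_or ab (eq_sym a) ca (eq_sym a) da (eq_sym b) cb
    (eq_sym b) db cd.
case: (first_hit_exists sgS hu ki kj li lj kl kv iv jv) => h.
- exists [:: i; j; k; l]; split=> //; first exact: uq.
  exact: (walk_quadrilateral sgS hu ki kj li lj kl kv lv iv jv h).
- exists [:: i; j; l; k]; split=> //; first exact: uq.
  exact: (walk_quadrilateral sgS hu li lj ki kj lk lv kv iv jv h).
- exists [:: j; i; k; l]; split=> //; first exact: uq.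
  rewrite (XC sgS).
  exact: (walk_quadrilateral sgS hu' kj ki lj li kl kv lv jv iv h).
- exists [:: j; i; l; k]; split=> //; first exact: uq.
  rewrite (XC sgS).
  exact: (walk_quadrilateral sgS hu' lj li kj ki lk lv kv jv iv h).
Qed.
End Eccentricity.

(** * Upper and lower bounds on walks in the whole arrangement *)

Section Distances.
Variables (I : finType) (P : eqType) (sg : I -> P -> int).
Variables (X : I -> I -> P) (e : I -> bool -> P).
Hypothesis sgS : sign_system sg X e.
Let sgP := sgP sgS.

(** The lines [i] and [j] are oriented towards [v], and all others towards the crossing of [i] and
    [j]. *)
Lemma normalizer i j v : i != j -> sg i v <> 0 -> sg j v <> 0 ->
  exists2 s : I -> int, forall c, s c = 1 \/ s c = -1 &
    [/\ corner (flip sg s) X i j, flip sg s i v = 1 & flip sg s j v = 1].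
Proof.
move=> ij iv jv.
pose t c x : int := if sg c x == -1 then -1 else 1.
have tP c x : sg c x <> 0 -> t c x * sg c x = 1.
  by rewrite /t; case: (sgP c x) => ->.
exists (fun c => if (c == i) || (c == j) then t c v else t c (X i j)).
  by move=> c; case: ifP => _; rewrite /t; case: ifP => _; [right|left|right|left].
split.
- split=> // m mi mj; rewrite /flip (negbTE mi) (negbTE mj) tP //.
  by apply: (sgX_neq0 sgS); neq.
- by rewrite /flip eqxx tP.
- by rewrite /flip eqxx orbT tP.
Qed.

Definition is_vertex u := exists i j, [/\ i != j, sg i u = 0 & sg j u = 0].

Lemma adj_on i j c u v : i != j -> c != i -> c != j ->
  sg i u = 0 -> sg j u = 0 -> sg i v = 0 -> sg c v = 0 ->
  forall S, i \in S -> j \in S -> c \in S -> nsep sg S u v = 0 ->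
  walk sg S 1 u v.
Proof.
move=> ij ci cj iu ju iv cv S iS jS cS n0.
have := straight sgS iS _ _ iu iv; rewrite n0; apply.
  by exists i, j.
by exists i, c; split=> //; rewrite eq_sym.
Qed.

(** Vertices on a common line are equal, or joined by one edge among three lines. Otherwise the four
    lines through them give two edges. *)
Lemma walk_lt_size u v : is_vertex u -> is_vertex v ->
  exists S N, [/\ uniq S, walk sg S N u v & (N + 2 <= size S)%N].
Proof.
have on i j v' u' : i != j -> sg i u' = 0 -> sg j u' = 0 -> is_vertex v' ->
    sg i v' = 0 ->
    exists S N, [/\ uniq S, walk sg S N u' v' & (N + 2 <= size S)%N].
  move=> ij iu ju [k [l [kl kv lv]]] iv.
  have [c [ci cv]] : exists c, c != i /\ sg c v' = 0.
    by have [ki|] := eqVneq k i; [exists l; rewrite -ki eq_sym|exists k].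
  have [cj|cj] := eqVneq c j.
    exists [:: i; j], 0%N; split; rewrite /= ?inE ?ij //.
    by rewrite cj in cv; rewrite (on2 sgS ij iu ju iv cv); apply: Walk0.
  exists [:: i; j; c], 1%N; split=> //.
    by rewrite /= !inE !negb_or ij (eq_sym i) ci (eq_sym j) cj.
  apply: (adj_on ij ci cj) => //; rewrite ?inE ?eqxx ?orbT //.
  by rewrite /nsep /= /sep iu ju cv; case: (sgP c u') => ->.
move=> [i [j [ij iu ju]]] vv.
have [|/eqP iv] := eqVneq (sg i v) 0; first exact: on iu ju vv.
have [|/eqP jv] := eqVneq (sg j v) 0; first by apply: on ju iu vv; rewrite eq_sym.
have [k [l [kl kv lv]]] := vv.
have [s sP [hu fi fj]] := normalizer ij iv jv.
have nv a b : sg a v <> 0 -> sg b v = 0 -> b != a.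
  by move=> av bv; apply: contra_notN av => /eqP <-.
have [S [uS w sS]] := walk2_normalized (sign_system_flip sgS sP) hu
  (nv _ _ iv kv) (nv _ _ jv kv) (nv _ _ iv lv) (nv _ _ jv lv) kl
  (proj2 (flip_eq0 sg sP _ _) kv) (proj2 (flip_eq0 sg sP _ _) lv) fi fj.
exists S, 2; split; rewrite ?sS // (X_uniq sgS ij iu ju).
exact: walk_flip w.
Qed.

Lemma shortcut_of_not_exterior u v : is_vertex u -> is_vertex v ->
  ~ exterior sg e u -> u <> v -> shortcut sg u v.
Proof.
have on i j v' u' : i != j -> sg i u' = 0 -> sg j u' = 0 -> is_vertex v' ->
    ~ exterior sg e u' -> u' <> v' -> sg i v' = 0 -> shortcut sg u' v'.
  move=> ij iu ju [k [l [kl kv lv]]] nE uv iv.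
  have [c [ci cv]] : exists c, c != i /\ sg c v' = 0.
    by have [ki|] := eqVneq k i; [exists l; rewrite -ki eq_sym|exists k].
  have [cj|cj] := eqVneq c j.
    by case: uv; rewrite cj in cv; apply: (on2 sgS ij).
  have ji : j != i by neq.
  have jv : sg j v' <> 0 by apply: (on3 sgS _ _ _ iv cv); neq.
  (* On a common line [i], the end of [i] pointing away from [v'] is separated from [u'] by some
     [m], since [u'] is not exterior. This [m] crosses [i] beyond [u'], hence not between [u'] and
     [v'], so there is one edge among four lines. *)
  have [b eb] : exists b, sg j (e i b) = - sg j v'.
    apply: (exists_end sgS) => //.
    by case: (sgP j v') jv => -> // _; [left|right].
  have [m [mu mi mb]] : exists m, [/\ sg m u' <> 0, m != i & sg m u' <> sg m (e i b)].
    pose p := [pred m | [&& sg m u' != 0, m != i & sg m u' != sg m (e i b)]].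
    have [/existsP[m /and3P[/eqP ? ? /eqP ?]]|/existsPn n] := boolP [exists m, p m].
      by exists m.
    case: nE; exists i, b => m /eqP m0 mi; apply/eqP.
    by move: (n m); rewrite /= m0 mi /= negbK.
  have mj : m != j by apply: contra_notN mu => /eqP ->.
  have ei := sg_end sgS i b.
  have sm : sep sg m u' (e i b).
    have := sg_end_neq0 sgS (b := b) mi; move: mu mb; rewrite /sep.
    by case: (sgP m u') => ->; case: (sgP m (e i b)) => ->.
  have jm : sg j (X i m) = sg j (e i b).
    have : sg j (X i m) <> 0 by apply: (sgX_neq0 sgS); neq.
    by case: (btw sgS iu ei sm (c' := j)) => [||->|->]; try neq; rewrite ?ju.
  have mv : sg m v' = sg m u'.
    apply: (ray sgS (i := j) (k := i)) => //; try neq.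
      by rewrite jm eb; move: jv; case: (sgP j v') => ->.
    by rewrite jm eb ju; move: jv; case: (sgP j v') => ->.
  have mc : m != c by apply: contra_notN mu => /eqP E; rewrite -mv E.
  exists [:: i; j; c; m], 1%N; split=> //.
    rewrite /= !inE !negb_or ij (eq_sym i) ci (eq_sym j) cj (eq_sym i) mi.
    by rewrite (eq_sym j) mj (eq_sym c) mc.
  apply: (adj_on ij ci cj) => //; rewrite ?inE ?eqxx ?orbT //.
  rewrite /nsep /= /sep iu ju cv mv oppr0 eqxx /=.
  by case: (sgP c u') => ->; case: (sgP m u') => ->.
move=> [i [j [ij iu ju]]] vv nE uv.
have [|/eqP iv] := eqVneq (sg i v) 0; first exact: on iu ju vv nE uv.
have [|/eqP jv] := eqVneq (sg j v) 0.
  by apply: on ju iu vv nE uv; rewrite eq_sym.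
have [k [l [kl kv lv]]] := vv.
have [s sP [hu fi fj]] := normalizer ij iv jv.
have nv a b : sg a v <> 0 -> sg b v = 0 -> b != a.
  by move=> av bv; apply: contra_notN av => /eqP <-.
rewrite (X_uniq sgS ij iu ju) in nE *.
apply: (shortcut_flip sP); apply: (shortcut_normalized (sign_system_flip sgS sP) hu
  (nv _ _ iv kv) (nv _ _ jv kv) (nv _ _ iv lv) (nv _ _ jv lv) kl) => //.
- exact/flip_eq0.
- exact/flip_eq0.
- by move/(exterior_flip sP).
Qed.

Lemma walk_le_card u v : is_vertex u -> is_vertex v ->
  walk sg (enum I) (#|I| - 2) u v.
Proof.
move=> vu vv; have [S [N [uS w SN]]] := walk_lt_size vu vv.
have SI : (size S <= #|I|)%N by rewrite -(card_uniqP uS) max_card.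
by apply: walk_le (walk_full sgS uS w); lia.
Qed.

Lemma walk_lt_card u v : is_vertex u -> is_vertex v -> ~ exterior sg e u ->
  walk sg (enum I) (#|I| - 3) u v.
Proof.
move=> vu vv nE; have [->|/eqP uv] := eqVneq u v; first exact: Walk0.
have [S [N [uS w SN]]] := shortcut_of_not_exterior vu vv nE uv.
have SI : (size S <= #|I|)%N by rewrite -(card_uniqP uS) max_card.
by apply: walk_le (walk_full sgS uS w); lia.
Qed.

(** As long as some line separates the current crossing from the end, its own crossing with [k] is
    closer to the end, as measured by [nsep]. *)
Lemma last_vertex k b : (1 < #|I|)%N -> exists2 m, m != k &
  forall c, c != k -> c != m -> sg c (X k m) = sg c (e k b).
Proof.
move=> I2; have [m0 m0k] : exists m, m != k.
  apply/existsP; rewrite -negb_forall; apply: contraTN I2 => /forallP h.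
  rewrite -leqNgt -(card1 k); apply: subset_leq_card; apply/fintype.subsetP => m _.
  by rewrite inE h.
have [N] := ubnP (nsep sg (enum I) (X k m0) (e k b)).
elim: N m0 m0k => // N IHN m mk; rewrite ltnS => le.
have km : k != m by neq.
have xk := sgX sgS km; have ek := sg_end sgS k b.
have [/existsP[c s]|/existsPn n] := boolP [exists c, sep sg c (X k m) (e k b)].
  apply: (IHN c); first by apply: contraTneq s => ->; rewrite /sep xk.
  have := leq_count3 (fun c' (_ : c' \in enum I) => sep_btw sgS c' xk ek s).
  have : (0 < count (fun c' => c' == c) (enum I))%N.
    by rewrite -has_count; apply/hasP; exists c; rewrite ?mem_enum.
  rewrite -/(nsep sg _ _ _) -/(nsep sg _ (X k c) (e k b)) -/(nsep sg _ (X k m) (e k b)).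
  lia.
exists m => // c ck cm; have := n c; rewrite /sep.
have := sgX_neq0 sgS (k := c) km ltac:(neq) ltac:(neq).
have := sg_end_neq0 sgS (b := b) ck.
by case: (sgP c (X k m)) => ->; case: (sgP c (e k b)) => ->.
Qed.

Lemma exists_exterior : (1 < #|I|)%N ->
  exists2 u, is_vertex u & exterior sg e u.
Proof.
move=> I2; have /card_gt0P[k _] : (0 < #|I|)%N by apply: leq_trans I2.
have [m mk h] := last_vertex k true I2; have km : k != m by neq.
exists (X k m).
  by exists k, m; split=> //; [apply: (sgX sgS)|apply: (sgXr sgS)].
exists k, true => c c0 ck; apply: h => //.
by apply: contra_notN c0 => /eqP ->; apply: (sgXr sgS).
Qed.

Lemma exterior_far u : (1 < #|I|)%N -> is_vertex u -> exterior sg e u ->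
  exists2 w, is_vertex w &
    forall N, walk sg (enum I) N u w -> (#|I| - 2 <= N)%N.
Proof.
move=> I2 [i [j [ij iu ju]]] [k [b hE]].
have [m mk h] := last_vertex k (~~ b) I2; have km : k != m by neq.
have kw := sgX sgS km; have mw := sgXr sgS km.
exists (X k m) => [|N /(sgdist_walk sgS (enum_uniq _)) D]; first by exists k, m.
have z x a a' : a != a' -> sg a x = 0 -> sg a' x = 0 ->
    (\sum_(c <- enum I) (sg c x == 0) <= 2)%N.
  move=> aa ax ax'.
  apply: (@leq_trans (\sum_(c <- enum I) (c == a) + \sum_(c <- enum I) (c == a'))).
    rewrite -big_split; apply: leq_sum => c _ /=.
    have [->|ca] := eqVneq c a; first by case: (_ == 0).
    have [->|ca'] := eqVneq c a'; first by case: (_ == 0).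
    have := on3 sgS aa (k := c) ltac:(neq) ltac:(neq) ax ax'.
    by case: eqP.
  have u1 := enum_uniq I.
  by rewrite (leq_add (sum_pred1_le _ u1) (sum_pred1_le _ u1)).
have z1 := z _ _ _ ij iu ju; have z2 := z _ _ _ km kw mw.
(* No line has [u] and [w] strictly on the same side, except possibly [k] or [m], which contain [w].
   So each line contributes at least 2 once zero signs are counted in. There are at most 4 zero
   signs, whence [sgdist] is at least twice [#|I| - 2]. *)
have : (\sum_(c <- enum I) 2 <= sgdist sg (enum I) u (X k m) +
    \sum_(c <- enum I) (sg c u == 0) + \sum_(c <- enum I) (sg c (X k m) == 0))%N.
  rewrite -!big_split; apply: leq_sum => c _ /=.
  have [ck|ck] := eqVneq c k.
    by rewrite ck kw; case: (sgP k u) => ->.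
  have [cm|cm] := eqVneq c m.
    by rewrite cm mw; case: (sgP m u) => ->.
  have := h c ck cm; rewrite (sg_end_opp sgS) => hc.
  have := sgX_neq0 sgS (k := c) km ltac:(neq) ltac:(neq).
  have := hE c ^~ ck; rewrite hc.
  by case: (sgP c u) => ->; case: (sgP c (e k b)) => -> //= H; have := H ltac:(by []).
rewrite big_const_seq count_predT -cardE iter_addn_0.
move: (sgdist _ _ _) D => d D /leq_trans - /(_ _ (leq_add (leq_add D z1) z2)).
by rewrite -addnA -[(2 + 2)%N]/(2.*2)%N -doubleD mul2n leq_double leq_subLR addnC.
Qed.
End Distances.

(** * Charts of the plane straightening a pseudoline *)

Local Open Scope classical_set_scope.

Section Connected.

Lemma connected_open_cover (T : topologicalType) (S O1 O2 : set T) :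
  connected S -> open O1 -> open O2 -> S `<=` O1 `|` O2 ->
  S `&` O1 `&` O2 `<=` set0 -> S `<=` O1 \/ S `<=` O2.
Proof.
move=> cS o1 o2 S12 S0; have [[x [Sx x1]]|n] := pselect (S `&` O1 !=set0).
  left; rewrite -(cS (S `&` O1)); first by move=> y [].
  - by exists x.
  - by exists O1.
  - exists (~` O2); first exact: open_closedC.
    apply/seteqP; split=> y [Sy y1]; split=> //; first by move=> y2; apply: (S0 y).
    by case: (S12 y Sy).
by right=> y Sy; case: (S12 y Sy) => // y1; case: n; exists y.
Qed.

Lemma open_cover_connected (T : topologicalType) (S : set T) :
  (forall O1 O2, open O1 -> open O2 -> S `<=` O1 `|` O2 ->
    S `&` O1 `&` O2 `<=` set0 -> S `<=` O1 \/ S `<=` O2) -> connected S.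
Proof.
move=> h B [x Bx] [V oV BV] [F cF BF].
have inV y : B y <-> S y /\ V y by rewrite {1}BV.
have inF y : B y <-> S y /\ F y by rewrite {1}BF.
case: (h V (~` F)) => //; first exact: closed_openC.
- move=> y Sy; have [Fy|] := pselect (F y); last by right.
  by left; case/inV: (proj2 (inF y) (conj Sy Fy)).
- by move=> y [[Sy Vy] nF]; case/inF: (proj2 (inV y) (conj Sy Vy)).
- move=> SV; apply/seteqP; split=> y; first by case/inV.
  by move=> Sy; apply/inV; split=> //; apply: SV.
- by move=> SF; case/inF: Bx => /SF.
Qed.

Lemma pairwise_connected (T : topologicalType) (S : set T) :
  (forall p q, S p -> S q -> connected_component S p q) -> connected S.
Proof.
move=> h; have [->|/set0P[p Sp]] := eqVneq S set0; first exact: connected0.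
have -> : S = connected_component S p.
  apply/seteqP; split=> [q Sq|]; first exact: h.
  exact: connected_component_sub.
exact: component_connected.
Qed.

Lemma path_component (R : realType) (T : topologicalType) (S : set T)
    (f : R -> T) a b : continuous f ->
  (forall s, a <= s <= b -> S (f s)) -> a <= b ->
  connected_component S (f a) (f b).
Proof.
move=> cf fS ab; exists [set f s | s in `[a, b]%classic]; last first.
  by exists b => //; rewrite /= ?in_itv /= ab lexx.
split; first by exists a => //; rewrite /= ?in_itv /= ab lexx.
  by move=> _ [s + <-] /=; rewrite ?in_itv /= => /fS.
apply: connected_continuous_connected; last exact: continuous_subspaceT.
by apply/connected_intervalP; apply: interval_is_interval.
Qed.

Lemma bounded_setE (K : realType) (V : normedModType K) (A : set V) :
  bounded_set A <-> exists r, forall p, A p -> `|p| <= r.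
Proof.
split=> [[M [_ h]]|[r h]].
  by exists (M + 1) => p Ap; apply: (h (M + 1)) => //; rewrite ltrDl.
by exists r; split; [exact: num_real|move=> x rx p /h /le_trans; apply; exact: ltW].
Qed.

Lemma norm_prodE (R : realType) (p : R * R) : `|p| = Num.max `|p.1| `|p.2|.
Proof. by []. Qed.

Lemma continuous_fst (T U : topologicalType) : continuous (@fst T U).
Proof. by move=> x; apply: cvg_fst. Qed.

Lemma continuous_snd (T U : topologicalType) : continuous (@snd T U).
Proof. by move=> x; apply: cvg_snd. Qed.

Lemma continuous_pair (T U V : topologicalType) (f : T -> U) (g : T -> V) :
  continuous f -> continuous g -> continuous (fun x => (f x, g x)).
Proof. by move=> cf cg x; apply: cvg_pair; [apply: cf|apply: cg]. Qed.

End Connected.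

Section Chart.
Variable R : realType.
Notation plane := (R * R)%type.

(** With the horizontal axis as model, sides of [l] are signs of the second coordinate and the order
    along [l] is that of the first. *)
Record chart (l : set plane) := Chart {
  straighten : plane -> plane;
  unstraighten : plane -> plane;
  straighten_cont : continuous straighten;
  unstraighten_cont : continuous unstraighten;
  straightenK : cancel straighten unstraighten;
  unstraightenK : cancel unstraighten straighten;
  chartE : l = [set p | (straighten p).2 = 0]
}.

Lemma pseudoline_chart (l : set plane) : pseudoline l -> inhabited (chart l).
Proof.
move=> [h [g [m [ch cg hg gh [[a [b [c [ab mE]]]] lE]]]]].
have d0 : a ^+ 2 + b ^+ 2 != 0.
  rewrite paddr_eq0 ?sqr_ge0 // !sqrf_eq0.
  by apply: contraNN ab => /andP[/eqP -> /eqP ->].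
(* A similarity with ratio the square root of [a ^+ 2 + b ^+ 2], taking the straight line [m] to the
   axis; [k] is its inverse. *)
pose f (p : plane) : plane := (b * p.1 - a * p.2, a * p.1 + b * p.2 - c).
pose k (q : plane) : plane :=
  ((b * q.1 + a * (q.2 + c)) / (a ^+ 2 + b ^+ 2),
   (b * (q.2 + c) - a * q.1) / (a ^+ 2 + b ^+ 2)).
have c1 : continuous (fun p : plane => p.1 : R) := @continuous_fst R R.
have c2 : continuous (fun p : plane => p.2 : R) := @continuous_snd R R.
have cl (x y z : R) : continuous (fun p : plane => x * p.1 + y * p.2 + z : R).
  move=> p; apply: cvgD; last exact: cvg_cst.
  by apply: cvgD; apply: cvgM; try exact: cvg_cst; [apply: c1|apply: c2].
have cf : continuous f.
  have -> : f = fun p => (b * p.1 + (- a) * p.2 + 0, a * p.1 + b * p.2 + (- c)).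
    by apply/funext => p; rewrite /f mulNr addr0.
  exact: (continuous_pair (cl _ _ _) (cl _ _ _)).
pose d := (a ^+ 2 + b ^+ 2)^-1.
have ck : continuous k.
  have -> : k = fun q => (d * b * q.1 + d * a * q.2 + d * a * c,
                          - (d * a) * q.1 + d * b * q.2 + d * b * c).
    by apply/funext => q; rewrite /k /d; congr pair; ring.
  exact: (continuous_pair (cl _ _ _) (cl _ _ _)).
have fk : cancel f k.
  by move=> [x y]; rewrite /k /f /=; congr pair; field.
have kf : cancel k f.
  by move=> [x y]; rewrite /k /f /=; congr pair; field.
constructor; apply: (@Chart l (f \o g) (h \o k)).
- by move=> x; apply: continuous_comp; [apply: cg|apply: cf].
- by move=> x; apply: continuous_comp; [apply: ck|apply: ch].
- by move=> x /=; rewrite fk gh.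
- by move=> x /=; rewrite hg kf.
- rewrite lE; apply/seteqP; split=> [_ [p + <-]|p] /=; rewrite mE /=.
    by move=> <-; rewrite hg subrr.
  by move=> /eqP; rewrite subr_eq0 => /eqP E; exists (g p).
Qed.

Section OneChart.
Variables (l : set plane) (G : chart l).

Definition height p := (straighten G p).2.
Definition pos p := (straighten G p).1.
Definition param s := unstraighten G (s, 0).
Definition side p : int := sgz (height p).

Lemma height_cont : continuous height.
Proof.
move=> x; apply: (continuous_comp (f := straighten G) (g := snd)).
  exact: straighten_cont.
exact: continuous_snd.
Qed.

Lemma pos_cont : continuous pos.
Proof.
move=> x; apply: (continuous_comp (f := straighten G) (g := fst)).
  exact: straighten_cont.
exact: continuous_fst.
Qed.

Lemma param_cont : continuous param.
Proof.
move=> x; apply: (continuous_comp (f := fun s => (s, 0)) (g := unstraighten G)).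
  by apply: (@continuous_pair _ _ _ (fun s => s) (fun=> 0)) => y;
    [exact: cvg_id|exact: cvg_cst].
exact: unstraighten_cont.
Qed.

Lemma mem_chart p : l p <-> height p = 0.
Proof. by have /(congr1 (fun A : set plane => A p)) -> := chartE G. Qed.

Lemma side_eq0 p : side p = 0 <-> l p.
Proof.
by rewrite mem_chart /side; split=> [/eqP|->]; rewrite ?sgz0 // sgz_eq0 => /eqP.
Qed.

Lemma posK s : pos (param s) = s.
Proof. by rewrite /pos /param unstraightenK. Qed.

Lemma param_on s : l (param s).
Proof. by apply/mem_chart; rewrite /height /param unstraightenK. Qed.

Lemma paramK p : l p -> param (pos p) = p.
Proof.
move=> /mem_chart h; rewrite /param /pos -h /height -surjective_pairing.
exact: straightenK.
Qed.

Lemma side_open s : s = 1 \/ s = -1 -> open [set p | side p = s].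
Proof.
case=> ->.
  rewrite (_ : [set p | _] = height @^-1` [set y | 0 < y]).
    by apply: open_comp; [move=> p _; apply: height_cont|exact: open_gt].
  by apply/seteqP; split=> p /=; rewrite /side -sgz_gt0; case: sgzP.
rewrite (_ : [set p | _] = height @^-1` [set y | y < 0]).
  by apply: open_comp; [move=> p _; apply: height_cont|exact: open_lt].
by apply/seteqP; split=> p /=; rewrite /side -sgz_lt0; case: sgzP.
Qed.

Lemma segment_component (S : set plane) p q :
  (forall s, 0 <= s <= 1 -> S (unstraighten G
    ((1 - s) * pos p + s * pos q, (1 - s) * height p + s * height q))) ->
  connected_component S p q.
Proof.
move=> h; pose f s := unstraighten G
  ((1 - s) * pos p + s * pos q, (1 - s) * height p + s * height q).
have f0 : f 0 = p.
  by rewrite /f subr0 !mul1r !mul0r !addr0 -surjective_pairing straightenK.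
have f1 : f 1 = q.
  by rewrite /f subrr !mul1r !mul0r !add0r -surjective_pairing straightenK.
rewrite -f0 -f1; apply: path_component => //.
have ca (a b : R) : continuous (fun s : R => (1 - s) * a + s * b : R).
  move=> s; apply: cvgD; apply: cvgM; try exact: cvg_cst; last exact: cvg_id.
  by apply: cvgB; [exact: cvg_cst|exact: cvg_id].
move=> s; apply: (continuous_comp (g := unstraighten G)).
  by apply: continuous_pair; apply: ca.
exact: unstraighten_cont.
Qed.

Lemma sgz_convex (a b s : R) : 0 <= s <= 1 -> sgz a = sgz b ->
  sgz ((1 - s) * a + s * b) = sgz a.
Proof.
move=> /andP[s0 s1]; case: (sgzP a) => a0.
- by move=> /esym/eqP; rewrite sgz_eq0 => /eqP ->; rewrite a0 !mulr0 addr0 sgz0.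
- move=> /esym/eqP; rewrite sgz_cp0 => b0; apply/eqP; rewrite sgz_cp0; nra.
- move=> /esym/eqP; rewrite sgz_cp0 => b0; apply/eqP; rewrite sgz_cp0; nra.
Qed.

(** Open half-planes of the chart are convex. By contraposition, the two points provided by
    [cross_once] have different sides. *)
Lemma same_side_component p q : ~ l p -> side p = side q ->
  connected_component (~` l) p q.
Proof.
move=> lp pq; apply: segment_component => s s01 /mem_chart.
rewrite /height unstraightenK /= => /eqP; rewrite -sgz_eq0 sgz_convex // => /eqP.
by move/(side_eq0 p).
Qed.

Lemma side_near p s (N : set plane) : s = 1 \/ s = -1 -> l p -> nbhs p N ->
  exists2 q, N q & side q = s.
Proof.
move=> sP lp Np; pose f (t : R) := unstraighten G (pos p, s%:~R * t).
have cf : continuous f.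
  move=> t; apply: (continuous_comp (g := unstraighten G)).
    apply: (@continuous_pair _ _ _ (fun=> pos p) (fun t : R => s%:~R * t : R)) => y.
      exact: cvg_cst.
    by apply: cvgM; [exact: cvg_cst|exact: cvg_id].
  exact: unstraighten_cont.
have f0 : f 0 = p by rewrite /f mulr0 -/(param (pos p)) paramK.
have : \forall t \near 0, N (f t) by apply: cf; rewrite f0.
move=> /nbhs_ballP[e e0 /(_ (e / 2))]; rewrite /= /ball /= sub0r normrN.
rewrite gtr0_norm ?divr_gt0 // => /(_ ltac:(by rewrite ltr_pdivrMr // ltr_pMr // ltr1n)) Nq.
exists (f (e / 2)) => //; rewrite /side /height /f unstraightenK /=.
by case: sP => ->; rewrite ?mul1r ?mulN1r ?sgzN gtr0_sgz ?divr_gt0.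
Qed.

Lemma param_near t (N : set plane) : nbhs (param t) N ->
  exists2 e : R, 0 < e & forall s, `|s - t| < e -> N (param s).
Proof.
move=> /param_cont /nbhs_ballP[e e0 h]; exists e => // s st.
by apply: h; rewrite /ball /= distrC.
Qed.

(** A bounded set lies in a compact square, on which the continuous function [pos] is bounded,
    whereas [pos] is unbounded along the ray. *)
Lemma ray_unbounded (A : set plane) (a : R) (b : bool) :
  (forall s, a <= s -> A (param (if b then s else - s))) -> ~ bounded_set A.
Proof.
move=> h /bounded_setE[r hr].
have cK : compact (`[- r, r]%classic `*` `[- r, r]%classic : set plane).
  by apply: compact_setX; apply: segment_compact.
have : bounded_set (pos @` (`[- r, r]%classic `*` `[- r, r]%classic)).
  apply: compact_bounded; apply: continuous_compact cK.
  exact/continuous_subspaceT/pos_cont.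
move=> /bounded_setE[r' hr'].
pose s := Num.max a (`|r'| + 1).
have := hr' (pos (param (if b then s else - s))).
rewrite posK => H; have {H} : `|if b then s else - s| <= r'.
  apply: H; exists (param (if b then s else - s)) => /=; last by rewrite posK.
  have := hr _ (h s ltac:(by rewrite le_max lexx)).
  rewrite norm_prodE ge_max => /andP[n1 n2].
  by split; rewrite /= ?in_itv /= -ler_norml.
have : `|r'| + 1 <= s by rewrite le_max lexx orbT.
have := ler_norm r'; have := ler_norm s; have := normr_ge0 r'.
by case: b {h}; rewrite ?normrN; lra.
Qed.

End OneChart.
End Chart.

(** * Crossings and betweenness in coordinates *)

Section Crossing.
Variable R : realType.
Notation plane := (R * R)%type.

Lemma ivt_sgz (f : R -> R) a b : continuous f -> a <= b ->
  (forall s, a <= s <= b -> f s <> 0) -> sgz (f a) = sgz (f b).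
Proof.
move=> cf ab f0.
have [c|n] := boolP (Num.min (f a) (f b) <= 0 <= Num.max (f a) (f b)).
  have [s] := IVT ab (continuous_subspaceT cf) c.
  by rewrite in_itv /= => /f0.
have := f0 a ltac:(by rewrite lexx ab); have := f0 b ltac:(by rewrite lexx ab).
move: n; rewrite ge_min le_max.
by case: (sgzP (f a)) => fa; case: (sgzP (f b)) => fb //; rewrite ?fa ?fb //= ?ltW
  ?orbT.
Qed.

Lemma opp_of_neq (a b : int) :
  a = 1 \/ a = -1 -> b = 1 \/ b = -1 -> a <> b -> a = - b.
Proof. by case=> ->; case=> ->. Qed.

(** Along [m] the height over [l] vanishes only at [x0], so its sign is constant on either half of
    [m]. The two constants are opposite because [m] visits two components of the complement of
    [l]. *)
Lemma cross_sign (l m : set plane) (Gl : chart l) (Gm : chart m) x0 :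
  cross_once l m -> l `&` m = [set x0] ->
  exists2 eps : int, eps = 1 \/ eps = -1 &
    forall p, m p -> side Gl p = eps * sgz (pos Gm p - pos Gm x0).
Proof.
move=> [_ [x [y [[mx lx] [my ly] nxy]]]] lm.
have /= [lx0 mx0] : (l `&` m) x0 by rewrite lm.
pose f s := height Gl (param Gm s).
have cf : continuous f.
  move=> s; apply: (continuous_comp (g := height Gl)).
    exact: param_cont.
  exact: height_cont.
pose t0 := pos Gm x0.
have f0 s : f s = 0 -> s = t0.
  move=> /(mem_chart Gl) ls.
  have : (l `&` m) (param Gm s) by split=> //; exact: param_on.
  by rewrite lm /= /t0 => <-; rewrite posK.
have sf p : m p -> side Gl p = sgz (f (pos Gm p)).
  by move=> mp; rewrite /f paramK.
have up s s' : t0 < s -> t0 < s' -> sgz (f s) = sgz (f s').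
  wlog ss : s s' / s <= s' => [w|].
    by case: (lerP s s') => [/w//|/ltW /w h] a b; rewrite h.
  move=> ts ts'; apply: ivt_sgz => // r /andP[sr _] /f0 rt.
  by move: (lt_le_trans ts sr); rewrite rt ltxx.
have dn s s' : s < t0 -> s' < t0 -> sgz (f s) = sgz (f s').
  wlog ss : s s' / s <= s' => [w|].
    by case: (lerP s s') => [/w//|/ltW /w h] a b; rewrite h.
  move=> ts ts'; apply: ivt_sgz => // r /andP[_ sr] /f0 rt.
  by move: (le_lt_trans sr ts'); rewrite rt ltxx.
have nz s : s <> t0 -> sgz (f s) = 1 \/ sgz (f s) = -1.
  by case: (sgzP (f s)) => [/f0//|_ _|_ _]; [left|right].
have neq0 p : m p -> ~ l p -> pos Gm p <> t0.
  by move=> mp lp /(congr1 (param Gm)); rewrite !paramK // => E; rewrite E in lp.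
have sxy : sgz (f (pos Gm x)) <> sgz (f (pos Gm y)).
  by rewrite -!sf // => E; apply: nxy; apply: same_side_component E.
have opp : sgz (f (t0 - 1)) = - sgz (f (t0 + 1)).
  have a1 : t0 < t0 + 1 by rewrite ltrDl.
  have a2 : t0 - 1 < t0 by rewrite ltrBlDr ltrDl.
  have nx := neq0 x mx lx; have ny := neq0 y my ly.
  have := nz _ nx; have := nz _ ny; move: sxy.
  case: (ltgtP (pos Gm x) t0) nx => // hx _; case: (ltgtP (pos Gm y) t0) ny => // hy _.
  - by rewrite (dn _ _ hx hy) => H; case: H.
  - rewrite (dn _ _ hx a2) (up _ _ hy a1) => ne n1 n2;
    exact: opp_of_neq n2 n1 ne.
  - rewrite (dn _ _ hy a2) (up _ _ hx a1) => ne n1 n2;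
    by apply: opp_of_neq n1 n2 _ => /esym.
  - by rewrite (up _ _ hx hy) => H; case: H.
exists (sgz (f (t0 + 1))).
  by apply: nz => /eqP; rewrite -subr_eq0 addrAC subrr add0r oner_eq0.
move=> p mp; rewrite sf //; case: (sgzP (pos Gm p - t0)).
- move=> /eqP; rewrite subr_eq0 => /eqP ->; rewrite mulr0.
  by apply/eqP; rewrite sgz_eq0; apply/eqP; rewrite /f /t0 paramK //; apply/mem_chart.
- rewrite subr_gt0 => h; rewrite mulr1; apply: up => //; first by rewrite ltrDl.
- rewrite subr_lt0 => h; rewrite mulrN1 -opp; apply: dn => //.
  by rewrite ltrBlDr ltrDl.
Qed.

(** The map [pos] identifies [l] with the real line, where removing a point disconnects exactly the
    points on its two sides. *)
Lemma betweenE (l : set plane) (G : chart l) u v w : l u -> l v -> l w ->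
  between l u v w <-> (pos G u < pos G w < pos G v \/ pos G v < pos G w < pos G u).
Proof.
have pinj p q : l p -> l q -> pos G p = pos G q -> p = q.
  by move=> lp lq E; rewrite -(paramK G lp) E paramK.
have sep a b c : l a -> l b -> l c -> pos G a < pos G c < pos G b ->
    ~ connected_component (l `\ c) a b.
  move=> la lb lc /andP[ac cb] [C [Ca CS cC] Cb].
  have := connected_continuous_connected cC
    (continuous_subspaceT (@pos_cont _ _ G)).
  move=> /connected_intervalP /(_ (pos G a) (pos G b)).
  move=> /(_ ltac:(by exists a) ltac:(by exists b) (pos G c)).
  rewrite (ltW ac) (ltW cb) => /(_ isT)[d Cd dc].
  by have [ld] := CS _ Cd; apply; apply: pinj.
have join a b c : l a -> l b -> l c -> pos G a <= pos G b ->
    ~ (pos G a <= pos G c <= pos G b) -> connected_component (l `\ c) a b.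
  move=> la lb lc ab nc; rewrite -(paramK G la) -(paramK G lb).
  apply: path_component => //; first exact: param_cont.
  move=> s hs; split; first exact: param_on.
  by move=> E; apply: nc; rewrite -E posK.
move=> lu lv lw; split.
  move=> [_ wu wv nc].
  have ne1 : pos G w != pos G u by apply/eqP => /(pinj _ _ lw lu).
  have ne2 : pos G w != pos G v by apply/eqP => /(pinj _ _ lw lv).
  have [uv|/ltW vu] := lerP (pos G u) (pos G v).
    left; apply/negPn/negP => h; apply: nc; apply: join => // h'.
    by move/negP: h; apply; rewrite !lt_neqAle eq_sym ne1 ne2.
  right; apply/negPn/negP => h; apply: nc; apply: connected_component_sym.
  apply: join => // h'; move/negP: h; apply.
  by rewrite !lt_neqAle (eq_sym (pos G v)) ne1 ne2.
move=> h; split=> //.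
- by move=> E; move: h; rewrite E ltxx andbF /= => -[].
- by move=> E; move: h; rewrite E ltxx andbF /= => -[].
- case: h => h; first exact: sep.
  by move/connected_component_sym; apply: sep.
Qed.

End Crossing.

(** * The sign vectors of an arrangement *)

(** The field [ray] in coordinates along [k], with [x] and [y] the positions of its crossings with
    [m] and [i]. *)
Lemma sgz_ray (R : realDomainType) (a b x y : R) : x != y ->
  sgz (a - y) <> sgz (x - y) -> sgz (b - y) <> sgz (x - y) ->
  sgz (a - x) = sgz (b - x).
Proof.
have key c : x != y -> sgz (c - y) <> sgz (x - y) -> sgz (c - x) = - sgz (x - y).
  case: (ltrgtP x y) => // xy _.
    rewrite (ltr0_sgz (x := x - y)) ?subr_lt0 // => h; apply/eqP.
    rewrite opprK sgz_cp0 subr_gt0; apply: lt_le_trans xy _.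
    by rewrite leNgt -subr_lt0; apply/negP => /ltr0_sgz.
  rewrite (gtr0_sgz (x := x - y)) ?subr_gt0 // => h; apply/eqP.
  rewrite sgz_cp0 subr_lt0; apply: le_lt_trans xy.
  by rewrite leNgt -subr_gt0; apply/negP => /gtr0_sgz.
by move=> ne h1 h2; rewrite !key.
Qed.

Lemma sgz_opp (R : realDomainType) (a b : R) :
  (sgz a != 0) && (sgz b == - sgz a) = (a < 0) && (0 < b) || (b < 0) && (0 < a).
Proof. by case: (sgzP a) => ha; case: (sgzP b) => hb. Qed.

Section Arrangement.
Variables (R : realType) (n : nat) (L : 'I_n -> set (R * R)).
Notation plane := (R * R)%type.
Variable G : forall i, chart (L i).
Hypothesis cross : forall i j, i != j -> cross_once (L i) (L j).
Hypothesis simple : forall i j k, i != j -> i != k -> j != k ->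
  L i `&` L j `&` L k = set0.

Definition sg i p := side (G i) p.
Definition crossing i j : plane := xget (0, 0) (L i `&` L j).

Lemma sg_eq0 i p : sg i p = 0 <-> L i p.
Proof. exact: side_eq0. Qed.

Lemma sg_cases i p : [\/ sg i p = -1, sg i p = 0 | sg i p = 1].
Proof.
rewrite /sg /side; case: sgzP => _; [constructor 2|constructor 3|constructor 1];
  by [].
Qed.

Lemma crossingC i j : crossing i j = crossing j i.
Proof. by rewrite /crossing setIC. Qed.

Lemma crossingE i j : i != j -> L i `&` L j = [set crossing i j].
Proof.
move=> /cross[[p E] _]; rewrite /crossing E; congr [set _].
by case: xgetP => [x -> //|/(_ p)]; case.
Qed.

Lemma crossing_on i j : i != j -> L i (crossing i j).
Proof. by move=> /crossingE E; have [] : (L i `&` L j) (crossing i j) by rewrite E. Qed.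

Lemma crossing_uniq i j p : i != j -> L i p -> L j p -> p = crossing i j.
Proof. by move=> /crossingE E ip jp; have : (L i `&` L j) p by []; rewrite E. Qed.

(** Tells at which end of [k] the positive side of [i] lies; the default 1 is never reached for
    distinct lines, by [orientP]. *)
Definition orient k i : int :=
  xget 1 [set eps | (eps = 1 \/ eps = -1) /\
    forall p, L k p -> sg i p = eps * sgz (pos (G k) p - pos (G k) (crossing k i))].

Lemma orientP k i : k != i -> (orient k i = 1 \/ orient k i = -1) /\
  forall p, L k p ->
    sg i p = orient k i * sgz (pos (G k) p - pos (G k) (crossing k i)).
Proof.
move=> ki; have ik : i != k by neq.
have [eps e1 h] := cross_sign (G i) (G k) (cross ik) (crossingE ik).
rewrite /orient; case: xgetP => [x -> //|/(_ eps)]; case; split=> //.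
by rewrite crossingC.
Qed.

Definition bound k : R := 1 + \sum_(c < n) `|pos (G k) (crossing k c)|.

Lemma lt_bound k c : `|pos (G k) (crossing k c)| < bound k.
Proof.
rewrite /bound (bigD1 c) //= addrCA ltr_pwDr //.
by rewrite ltr_pwDl // sumr_ge0.
Qed.

Definition far_point k (b : bool) : plane :=
  param (G k) (if b then bound k else - bound k).

Definition bsign (b : bool) : int := if b then 1 else -1.

Lemma sg_beyond k (b : bool) i s : k != i ->
  (forall c, c != k -> if b then pos (G k) (crossing k c) < s
                       else s < pos (G k) (crossing k c)) ->
  sg i (param (G k) s) = orient k i * bsign b.
Proof.
move=> ki h; rewrite (orientP ki).2 ?posK; last exact: param_on.
have := h i ltac:(neq); rewrite /bsign; case: b {h} => h.
  by congr (_ * _); apply/eqP; rewrite sgz_cp0 subr_gt0.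
by congr (_ * _); apply/eqP; rewrite sgz_cp0 subr_lt0.
Qed.

Lemma sg_far_point k b i : k != i -> sg i (far_point k b) = orient k i * bsign b.
Proof.
move=> ki; apply: sg_beyond => // c _.
have := lt_bound k c; rewrite ltr_norml => /andP[].
by case: b => // + _; rewrite ltrNl => ?; rewrite ltrNl.
Qed.

Lemma arrangement_sign_system : sign_system sg crossing far_point.
Proof.
split.
- exact: sg_cases.
- exact: crossingC.
- by move=> i j ij; apply/sg_eq0; apply: crossing_on.
- by move=> i j x ij /sg_eq0 ix /sg_eq0; apply: crossing_uniq.
- move=> i j k ij ik jk /sg_eq0 kx.
  have : (L i `&` L j `&` L k) (crossing i j).
    by split=> //; split; [|rewrite crossingC]; apply: crossing_on; neq.
  by rewrite simple.
- move=> i m k p q im ik mk /sg_eq0 kp /sg_eq0 kq.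
  have ki : k != i by neq. have km : k != m by neq.
  have [oi hi] := orientP ki; have [om hm] := orientP km.
  rewrite (hi p) // (hi q) // hi ?(hm p) ?(hm q) //; last exact: crossing_on.
  have ne : pos (G k) (crossing k m) != pos (G k) (crossing k i).
    apply/eqP => E.
    have {}E : crossing k m = crossing k i.
      by rewrite -(paramK (G k) (crossing_on km)) E paramK //; apply: crossing_on.
    have : (L k `&` L m `&` L i) (crossing k m).
      split; last by rewrite E crossingC; apply: crossing_on; neq.
      by split; [|rewrite crossingC]; apply: crossing_on; neq.
    by rewrite simple // eq_sym.
  by move=> h1 h2; congr (_ * _); apply: sgz_ray ne _ _ => E; [apply: h1|apply: h2];
    rewrite E.
- by move=> k b; apply/sg_eq0; apply: param_on.
- move=> c k b ck; rewrite sg_far_point; last neq.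
  have [[] -> _] := orientP (k := k) (i := c) ltac:(neq); by case: b.
- move=> c k b; have [->|ck] := eqVneq c k.
    have z b' : sg k (far_point k b') = 0 by apply/sg_eq0; apply: param_on.
    by rewrite !z.
  by rewrite !sg_far_point; try neq; case: b; rewrite /= ?mulrN1 ?mulr1 ?opprK.
Qed.

Lemma verticesE u : vertices L u <-> is_vertex sg u.
Proof.
split=> [[i [j [ij iu ju]]]|[i [j [ij /sg_eq0 iu /sg_eq0 ju]]]]; last by exists i, j.
by exists i, j; split=> //; apply/sg_eq0.
Qed.

Lemma vtx_full u : vtx sg (enum 'I_n) u <-> is_vertex sg u.
Proof.
split=> [[i [j [_ _ ij iu ju]]]|[i [j [ij iu ju]]]]; first by exists i, j.
by exists i, j; rewrite !mem_enum.
Qed.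

Lemma sep_between i c u v : i != c -> L i u -> L i v ->
  sep sg c u v <-> between (L i) u v (crossing i c).
Proof.
move=> ic iu iv; have [oc hc] := orientP ic.
rewrite (betweenE (G i)) //; last exact: crossing_on.
have -> : sep sg c u v = (sgz (pos (G i) u - pos (G i) (crossing i c)) != 0) &&
  (sgz (pos (G i) v - pos (G i) (crossing i c)) ==
   - sgz (pos (G i) u - pos (G i) (crossing i c))).
  rewrite /sep (hc u) // (hc v) //; case: oc => ->; rewrite ?mul1r //.
  by rewrite !mulN1r oppr_eq0 eqr_opp.
move: (pos _ u) (pos _ v) (pos _ (crossing i c)) => a b x.
rewrite sgz_opp !subr_lt0 !subr_gt0.
by split=> [/orP[]|[]] h; [left|right|apply/orP; left|apply/orP; right].
Qed.

(** A vertex between [u] and [v] on [L i] is the crossing of [L i] with some other line, and by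
    [sep_between] it lies between them exactly when that line separates them. *)
Lemma adjacentE u v : Defs.adjacent L u v <-> adj sg (enum 'I_n) u v.
Proof.
split=> [[/verticesE vu /verticesE vv uv [i [iu iv b0]]]|].
  split=> //; [exact/vtx_full|exact/vtx_full| |].
    by exists i; rewrite ?mem_enum //; split; apply/sg_eq0.
  move=> c _; apply/negP => s; have [ic|ic] := eqVneq i c.
    by move: s; rewrite /sep -ic (proj2 (sg_eq0 i u) iu).
  have : (between (L i) u v `&` vertices L) (crossing i c).
    split; first exact/sep_between.
    by exists i, c; split=> //; [|rewrite crossingC]; apply: crossing_on; neq.
  by rewrite b0.
move=> [/vtx_full vu /vtx_full vv uv [i _ [/sg_eq0 iu /sg_eq0 iv]] h].
split=> //; [exact/verticesE|exact/verticesE|exists i; split=> //].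
rewrite -subset0 => w [bw [k [l [kl kw lw]]]].
have iw : L i w by case: bw.
have [c [ic cw]] : exists c, i != c /\ L c w.
  have [ik|ik] := eqVneq i k; last by exists k.
  by exists l; rewrite ik.
move: (h c); rewrite mem_enum => /(_ isT) /negP; apply.
by apply/(sep_between ic iu iv); rewrite -(crossing_uniq ic iw cw).
Qed.

Lemma walk_dist N u v : walk sg (enum 'I_n) N u v -> (dist L u v <= N%:R%:E)%E.
Proof.
move=> w; have [p [pp pv pN]] : exists p, [/\
    path (fun x y => `[< Defs.adjacent L x y >]) u p, last u p = v & (size p <= N)%N].
  elim: w => [{}N {}u|{}N {}u y {}v a _ [p [pp pv pN]]]; first by exists [::].
  by exists (y :: p); split=> //=; rewrite pp andbT; apply/asboolP/adjacentE.
apply: (@le_trans _ _ (size p)%:R%:E); last by rewrite lee_fin ler_nat.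
by apply: ereal_inf_lbound; exists p.
Qed.

Lemma dist_ge N u v :
  (forall M, walk sg (enum 'I_n) M u v -> (N <= M)%N) ->
  (N%:R%:E <= dist L u v)%E.
Proof.
move=> h; apply: le_ereal_inf_tmp => _ [p [pp pv] <-]; rewrite lee_fin ler_nat.
apply: h; elim: p u pp pv => [|y p IHp] u /=; first by move=> _ ->; apply: Walk0.
by move=> /andP[/asboolP/adjacentE a pp] pv; apply: WalkS a (IHp _ pp pv).
Qed.

Hypothesis n3 : (3 <= n)%N.

Lemma eccentricity_le u : vertices L u -> (eccentricity L u <= (n - 2)%:R%:E)%E.
Proof.
move=> /verticesE vu; apply: ge_ereal_sup => _ [v /verticesE vv <-].
apply: walk_dist; rewrite -[X in (X - 2)%N]card_ord.
exact: walk_le_card arrangement_sign_system _ _ vu vv.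
Qed.

Lemma eccentricity_exterior u : vertices L u -> exterior sg far_point u ->
  eccentricity L u = (n - 2)%:R%:E.
Proof.
move=> vu eu; apply/eqP; rewrite eq_le eccentricity_le //=.
have I2 : (1 < #|'I_n|)%N by rewrite card_ord ltnW.
have [w /verticesE vw h] :=
  exterior_far arrangement_sign_system I2 (proj1 (verticesE u) vu) eu.
apply: (@le_trans _ _ (dist L u w)).
  by apply: dist_ge => M /h; rewrite card_ord.
by apply: ereal_sup_ubound; exists w.
Qed.

Lemma eccentricity_not_exterior u : vertices L u -> ~ exterior sg far_point u ->
  (eccentricity L u < (n - 2)%:R%:E)%E.
Proof.
move=> /verticesE vu eu; apply: (@le_lt_trans _ _ (n - 3)%:R%:E); last first.
  by rewrite lte_fin ltr_nat; lia.
apply: ge_ereal_sup => _ [v /verticesE vv <-].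
apply: walk_dist; rewrite -[X in (X - 3)%N]card_ord.
exact: walk_lt_card arrangement_sign_system _ _ vu vv eu.
Qed.

Lemma diameterE : diameter L = (n - 2)%:R%:E.
Proof.
apply/eqP; rewrite eq_le; apply/andP; split.
  by apply: ge_ereal_sup => _ [u vu <-]; apply: eccentricity_le.
have I2 : (1 < #|'I_n|)%N by rewrite card_ord ltnW.
have [u /verticesE vu eu] := exists_exterior arrangement_sign_system I2.
rewrite -(eccentricity_exterior vu eu).
by apply: ereal_sup_ubound; exists u.
Qed.

Lemma diametricalE u : vertices L u ->
  diametrical L u <-> exterior sg far_point u.
Proof.
move=> vu; rewrite /diametrical diameterE; split=> [E|]; last first.
  exact: eccentricity_exterior.
apply: contrapT => /(eccentricity_not_exterior vu).
by rewrite E ltxx.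
Qed.

End Arrangement.

(** * Cells and the outer face *)

Section Plane.
Variable R : realType.
Notation plane := (R * R)%type.

Lemma convex_gt0 (s a b : R) : 0 <= s <= 1 -> 0 < a -> 0 < b ->
  0 < (1 - s) * a + s * b.
Proof. by move=> /andP[s0 s1] a0 b0; nra. Qed.

Lemma convex_ball (s c e a b : R) : 0 <= s <= 1 -> ball c e a -> ball c e b ->
  ball c e ((1 - s) * a + s * b).
Proof.
rewrite /ball /= !ltr_norml => s01 /andP[a1 a2] /andP[b1 b2].
have h1 := convex_gt0 s01 (a := e - (c - a)) (b := e - (c - b)).
have h2 := convex_gt0 s01 (a := c - a + e) (b := c - b + e).
apply/andP; split.
  by rewrite -subr_gt0; have := h2 ltac:(lra) ltac:(lra); lra.
by rewrite -subr_gt0; have := h1 ltac:(lra) ltac:(lra); lra.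
Qed.

(* If two open sets separate one side of [l] in [C], then near each point of [l]
   this side meets only one of them, always the same one by connectedness of
   [C `&` l]; the other one would then be separated in [C] itself. *)
Lemma split_connected (l : set plane) (G : chart l) (C : set plane) (s : int) :
  s = 1 \/ s = -1 -> open C -> connected C ->
  (forall p q z, l p -> l q -> l z -> C p -> C q ->
    pos G p <= pos G z <= pos G q -> C z) ->
  connected (C `&` [set p | side G p = s]).
Proof.
move=> sP oC cC conv; set Cs := _ `&` _.
have oCs : open Cs by apply: openI => //; apply: side_open.
apply: open_cover_connected => O1 O2 o1 o2 cov dis.
(* Near a point of [good V], the chosen side of [C] is contained in [V]; away from that side of [l]
   this holds vacuously. *)
pose good V := ([set q | Cs q -> V q])°.
have goodo V : open (good V) by apply: open_interior.
(* In the chart, half of a small box around [x] is convex, hence connected, so only one of the two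
   sets meets it. *)
have local x : C x -> l x -> good O1 x \/ good O2 x.
  move=> Cx lx; have : nbhs (straighten G x) [set q | C (unstraighten G q)].
    by apply: unstraighten_cont; rewrite straightenK; apply: open_nbhs_nbhs.
  move=> /nbhs_ballP[r r0 hr].
  pose Q := [set p | ball (straighten G x) r (straighten G p) /\ side G p = s].
  have QC : Q `<=` Cs.
    by move=> p [pb ps]; split=> //; have := hr _ pb; rewrite /= straightenK.
  have cQ : connected Q.
    apply: pairwise_connected => p q [[p1 p2] ps] [[q1 q2] qs].
    apply: (segment_component (G := G)) => t t01; split.
      by rewrite unstraightenK; split; apply: convex_ball.
    by rewrite /side /height unstraightenK sgz_convex // -/(side G q) qs.
  have nx : nbhs x [set p | ball (straighten G x) r (straighten G p)].
    by apply: straighten_cont; apply: nbhsx_ballx.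
  have [h|h] : Q `<=` O1 \/ Q `<=` O2.
  - apply: connected_open_cover => //.
      by move=> p /QC /cov.
    by move=> p [[/QC pC p1] p2]; apply: (dis p).
  - left; apply: filterS nx => p pb [Cp ps]; exact: h.
  - right; apply: filterS nx => p pb [Cp ps]; exact: h.
have cT : connected [set t | C (param G t)].
  apply/connected_intervalP => a b Ca Cb t tab.
  by apply: (conv _ _ (param G t)) Ca Cb _; rewrite ?posK //; apply: param_on.
(* If all points of [C] on [l] are good for [V1], then [good V1] and the part of [Cs] in [V2] are
   open, cover [C] and are disjoint there. *)
have fin V1 V2 : open V1 -> open V2 -> Cs `<=` V1 `|` V2 ->
    Cs `&` V1 `&` V2 `<=` set0 ->
    [set t | C (param G t)] `<=` param G @^-1` good V1 -> Cs `<=` V1 \/ Cs `<=` V2.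
  move=> v1 v2 cv dv T1.
  have [h|h] : C `<=` good V1 \/ C `<=` Cs `&` V2.
  - apply: connected_open_cover => //; first exact: openI.
      move=> x Cx; have [xs|xs] := pselect (side G x = s).
        have Csx : Cs x by [].
        case: (cv x Csx) => xV; [left|right] => //.
        by apply: filterS (open_nbhs_nbhs (conj v1 xV)) => q Vq _.
      left; have [lx|lx] := pselect (l x).
        by have := T1 (pos G x); rewrite /= paramK //; apply.
      have xs' : side G x = - s.
        have : side G x <> 0 by move/(side_eq0 G x).
        move: xs; rewrite /side; case: sP => ->; case: sgzP => //.
      have o' : open [set p | side G p = - s].
        by apply: side_open; case: sP => ->; [right|left].
      apply: filterS (open_nbhs_nbhs (conj o' xs')) => q /= qs [_ /=].
      by rewrite qs; case: sP => ->.
    move=> x [[Cx /nbhs_singleton g] [Csx xV]].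
    by apply: (dv x); split=> //; split=> //; apply: g.
  - by left=> x [Cx xs]; apply: (nbhs_singleton (h x Cx)).
  - by right=> x [Cx xs]; have [] := h x Cx.
have [h|h] : [set t | C (param G t)] `<=` param G @^-1` good O1 \/
             [set t | C (param G t)] `<=` param G @^-1` good O2.
- have op V : open (param G @^-1` good V).
    by apply: open_comp => // t _; apply: param_cont.
  apply: connected_open_cover => //.
    by move=> t Ct; apply: local => //; apply: param_on.
  move=> t [[Ct g1] g2].
  have nC : nbhs (param G t) C by apply: open_nbhs_nbhs.
  have [q [[q1 q2] Cq] qs] := side_near G sP (param_on G t)
    (filterI (filterI g1 g2) nC).
  by apply: (dis q); split; [split|]; [|apply: q1|apply: q2].
- exact: fin.
- by apply/or_comm; apply: fin => //; [rewrite setUC|rewrite setIAC].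
Qed.

Definition axis_chart : chart [set p : plane | p.2 = 0].
Proof.
by apply: (@Chart R _ id id) => //; move=> x; exact: cvg_id.
Defined.

Lemma axis_component (S : set plane) (p q : plane) :
  (forall s, 0 <= s <= 1 ->
    S ((1 - s) * p.1 + s * q.1, (1 - s) * p.2 + s * q.2)) ->
  connected_component S p q.
Proof. exact: (segment_component (G := axis_chart)). Qed.

Lemma plane_connected : connected [set: plane].
Proof. by apply: pairwise_connected => p q _ _; apply: axis_component. Qed.

(** For the maximum norm this is a union of four half-planes, each of which reaches [(r + 1, r + 1)]
    directly or through a neighbouring one. *)
Lemma norm_exterior_connected (r : R) : 0 <= r ->
  connected [set p : plane | r < `|p|].
Proof.
move=> r0; set S := [set _ | _].
have SE (p : plane) : S p <-> [\/ r < p.1, r < p.2, p.1 < - r | p.2 < - r].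
  rewrite /S /= norm_prodE lt_max !ltr_normr; split.
    case/orP => /orP[] h; [constructor 1|constructor 3|constructor 2|constructor 4];
      by rewrite 1?ltrNr.
  by case=> h; rewrite ?h ?orbT // ltrNr in h *; rewrite h ?orbT.
have e1 (p q : plane) : r < p.1 -> r < q.1 -> connected_component S p q.
  move=> hp hq; apply: axis_component => s s01; apply/SE; constructor 1 => /=.
  have := convex_gt0 s01 (a := p.1 - r) (b := q.1 - r); rewrite !subr_gt0.
  by move=> /(_ hp hq); lra.
have e2 (p q : plane) : r < p.2 -> r < q.2 -> connected_component S p q.
  move=> hp hq; apply: axis_component => s s01; apply/SE; constructor 2 => /=.
  have := convex_gt0 s01 (a := p.2 - r) (b := q.2 - r); rewrite !subr_gt0.
  by move=> /(_ hp hq); lra.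
have e3 (p q : plane) : p.1 < - r -> q.1 < - r -> connected_component S p q.
  move=> hp hq; apply: axis_component => s s01; apply/SE; constructor 3 => /=.
  have := convex_gt0 s01 (a := - r - p.1) (b := - r - q.1); rewrite !subr_gt0.
  by move=> /(_ hp hq); lra.
have e4 (p q : plane) : p.2 < - r -> q.2 < - r -> connected_component S p q.
  move=> hp hq; apply: axis_component => s s01; apply/SE; constructor 4 => /=.
  have := convex_gt0 s01 (a := - r - p.2) (b := - r - q.2); rewrite !subr_gt0.
  by move=> /(_ hp hq); lra.
have base (p : plane) : S p -> connected_component S p (r + 1, r + 1).
  case/SE => h.
  - by apply: e1 => //=; lra.
  - by apply: e2 => //=; lra.
  - apply: (connected_component_trans (y := (- r - 1, r + 1))).
      by apply: e3 => //=; lra.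
    by apply: e2 => /=; lra.
  - apply: (connected_component_trans (y := (r + 1, - r - 1))).
      by apply: e4 => //=; lra.
    by apply: e1 => /=; lra.
apply: pairwise_connected => p q /base hp /base hq.
exact: connected_component_trans hp (connected_component_sym hq).
Qed.

End Plane.

Lemma sgz_between (R : realDomainType) (a b z x : R) :
  sgz (a - x) = sgz (b - x) -> a <= z <= b -> sgz (z - x) = sgz (a - x).
Proof.
move=> E /andP[az zb]; case: (sgzP (a - x)) E => h.
- move=> /esym/eqP; rewrite sgz_eq0 subr_eq0 => /eqP bx.
  have ax : a = x by apply/eqP; rewrite -subr_eq0 h.
  have -> : z = x by apply/eqP; rewrite eq_le -{1}bx zb -ax.
  by rewrite subrr sgz0.
- move=> _; apply/eqP; rewrite sgz_cp0 subr_gt0; apply: lt_le_trans az.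
  by rewrite -subr_gt0.
- move=> /esym/eqP; rewrite sgz_cp0 subr_lt0 => bx; apply/eqP.
  by rewrite sgz_cp0 subr_lt0; apply: le_lt_trans bx.
Qed.

Lemma nbhs_all (T : topologicalType) (x : T) (P : set T) :
  (forall y, P y) -> nbhs x P.
Proof. by move=> h; apply: filterS filterT. Qed.

Lemma nbhs_forall (I : finType) (T : topologicalType) (x : T) (f : I -> set T) :
  (forall i, nbhs x (f i)) -> nbhs x [set p | forall i, f i p].
Proof. exact: filter_forall. Qed.

(** * Unbounded cells and the outer face of the drawing *)

Section OuterFace.
Variables (R : realType) (n : nat) (L : 'I_n -> set (R * R)).
Notation plane := (R * R)%type.
Variable G : forall i, chart (L i).
Hypothesis cross : forall i j, i != j -> cross_once (L i) (L j).
Hypothesis simple : forall i j k, i != j -> i != k -> j != k ->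
  L i `&` L j `&` L k = set0.
Let sgS := arrangement_sign_system G cross simple.
Notation sg := (sg G).
Notation crossing := (crossing L).
Notation far_point := (far_point G).

Definition cell (A : seq 'I_n) (s : 'I_n -> int) : set plane :=
  [set p | forall m, m \in A -> sg m p = s m].

Lemma cell_cons m A s :
  cell (m :: A) s = cell A s `&` [set p | side (G m) p = s m].
Proof.
apply/seteqP; split=> [p h|p [h hm] k]; last first.
  by rewrite inE => /predU1P[->//|/h].
split=> [k kA|]; first by apply: h; rewrite inE kA orbT.
by apply: h; rewrite mem_head.
Qed.

Lemma cell_open A s : (forall m, s m = 1 \/ s m = -1) -> open (cell A s).
Proof.
move=> sP; elim: A => [|m A IHA].
  by rewrite (_ : cell _ _ = setT); [exact: openT|apply/seteqP; split].
by rewrite cell_cons; apply: openI IHA _; apply: side_open.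
Qed.

(** The lines are added one at a time. Along a new line [m] every other sign changes at a single
    position, so the old cell meets [m] in an interval and [split_connected] applies. *)
Lemma cell_connected A s : uniq A -> (forall m, s m = 1 \/ s m = -1) ->
  connected (cell A s).
Proof.
move=> + sP; elim: A => [_|m A IHA /= /andP[mA uA]].
  rewrite (_ : cell _ _ = setT); first exact: plane_connected.
  by apply/seteqP; split.
rewrite cell_cons; apply: split_connected => //; first exact: cell_open.
  exact: IHA.
move=> p q z mp mq mz pA qA pzq c cA.
have mc : m != c by apply: contraNneq mA => ->.
have [oe h] := orientP G cross mc; rewrite -(pA c cA) (h p mp) (h z mz).
congr (_ * _); apply: sgz_between pzq.
have := etrans (pA c cA) (esym (qA c cA)); rewrite (h p mp) (h q mq).
by case: oe => ->; rewrite ?mul1r ?mulN1r // => /oppr_inj.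
Qed.

Lemma realization_sub p : realization L p -> exists i, L i p.
Proof. by move=> [i _ [ip _]]; exists i. Qed.

Lemma cell_realization s : (forall m, s m = 1 \/ s m = -1) ->
  cell (enum 'I_n) s `<=` ~` realization L.
Proof.
move=> sP p h /realization_sub[i /(sg_eq0 G) ip].
by have := h i (mem_enum _ _); rewrite ip; case: (sP i) => ->.
Qed.

(** A connected part of [L k] without vertices cannot pass the crossings on either side of [p], so
    it stays in the compact arc between them. *)
Lemma mem_realization k c c' p : L k p -> k != c -> k != c' ->
  pos (G k) (crossing k c) <= pos (G k) p <= pos (G k) (crossing k c') ->
  realization L p.
Proof.
move=> kp kc kc' h; exists k => //; split=> // -[[_ nv]]; apply.
have ne d : k != d -> pos (G k) (crossing k d) != pos (G k) p.
  move=> kd; apply/eqP => E; apply: nv; exists k, d; split=> //.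
  have -> : p = crossing k d.
    by rewrite -(paramK (G k) kp) -E paramK //; apply: (crossing_on cross).
  by rewrite crossingC; apply: (crossing_on cross); neq.
have cK : compact (param (G k) @` `[pos (G k) (crossing k c), pos (G k) (crossing k c')]).
  apply: continuous_compact; last exact: segment_compact.
  exact/continuous_subspaceT/param_cont.
have /bounded_setE[r hr] := compact_bounded cK.
apply/bounded_setE; exists r => q [C [Cp CS cC] Cq]; apply: hr.
have [kq _] := CS q Cq.
exists (pos (G k) q) => /=; last exact: paramK.
have nd d : k != d -> ~ (exists2 x, C x & pos (G k) x = pos (G k) (crossing k d)).
  move=> kd [x Cx E]; have [kx] := CS x Cx; apply; exists k, d; split=> //.
  have -> : x = crossing k d.
    by rewrite -(paramK (G k) kx) E paramK //; apply: (crossing_on cross).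
  by rewrite crossingC; apply: (crossing_on cross); neq.
have := connected_continuous_connected cC
  (continuous_subspaceT (@pos_cont _ _ (G k))).
move=> /connected_intervalP iC.
have {}iC a b t : C a -> C b -> pos (G k) a <= t <= pos (G k) b ->
    exists2 x, C x & pos (G k) x = t.
  by move=> Ca Cb; apply: iC; [exists a|exists b].
case/andP: h => h1 h2; rewrite /= in_itv /=; apply/andP; split.
  rewrite leNgt; apply/negP => lt; apply: (nd c kc).
  by apply: (iC q p) => //; rewrite (ltW lt).
rewrite leNgt; apply/negP => lt; apply: (nd c' kc').
by apply: (iC p q) => //; rewrite (ltW lt) h2.
Qed.

Lemma exterior_on_outer_face u : vertices L u -> exterior sg far_point u ->
  on_outer_face L u.
Proof.
move=> [i [j [ij iu ju]]] [k [b hE]] N Nu.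
have [ou hu] := orientP G cross ij.
(* The signs of an unbounded cell at [u] along the end [b] of [k]. If [k] passes through [u], either
   side of [k] will do and 1 is taken. *)
pose s c : int := if c == k then (if sg k u == 0 then 1 else sg k u)
                  else sg c (far_point k b).
have sP c : s c = 1 \/ s c = -1.
  rewrite /s; case: eqVneq => [_|ck].
    by case: (sg_cases G k u) => ->; [right|left|left].
  have := sg_end_neq0 sgS (b := b) ck.
  by case: (sg_cases G c (far_point k b)) => -> //; [right|left].
have su c : sg c u <> 0 -> sg c u = s c.
  rewrite /s; case: (eqVneq c k) => [->|ck] c0; last exact: hE.
  by case: eqP.
pose D := [set p | forall c, sg c u <> 0 -> sg c p = sg c u].
have nD : nbhs u D.
  apply: (nbhs_forall (f := fun c p => sg c u <> 0 -> sg c p = sg c u)).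
  move=> c; have [c0|c0] := pselect (sg c u = 0).
    by apply: nbhs_all => y; case.
  have oc : open [set p | side (G c) p = sg c u] by apply: side_open; rewrite su.
  by apply: filterS (open_nbhs_nbhs (conj oc (erefl (sg c u)))) => p h _.
have /nbhs_interior nO : nbhs u (N `&` D) by apply: filterI.
have [e e0 he] : exists2 e : R, 0 < e &
    forall t, `|t - pos (G i) u| < e -> (N `&` D)° (param (G i) t).
  by apply: param_near; rewrite paramK.
(* The cell is entered near [u] in two moves: along [i] to the right side of [j], then off [i] to
   its right side. *)
have [q Oq [iq jq]] : exists2 q, (N `&` D)° q & L i q /\ sg j q = s j.
  have e2 : `|e / 2| < e.
    by rewrite gtr0_norm ?divr_gt0 // ltr_pdivrMr // ltr_pMr // ltr1n.
  have um : u = crossing i j by apply: (crossing_uniq cross).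
  have [osj|osj] : orient G i j = s j \/ orient G i j = - s j.
    by case: ou => ->; case: (sP j) => ->; [left|right|right|left].
    exists (param (G i) (pos (G i) u + e / 2)).
      by apply: he; rewrite addrAC subrr add0r.
    split; first exact: param_on.
    rewrite hu ?posK -?um; last exact: param_on.
    by rewrite addrAC subrr add0r gtr0_sgz ?divr_gt0 // mulr1.
  exists (param (G i) (pos (G i) u - e / 2)).
    by apply: he; rewrite addrAC subrr add0r normrN.
  split; first exact: param_on.
  rewrite hu ?posK -?um; last exact: param_on.
  by rewrite addrAC subrr add0r sgzN gtr0_sgz ?divr_gt0 // osj mulrN1 opprK.
have oj : open [set p | side (G j) p = s j] by apply: side_open.
have [p [[Np Dp] jp] ip] : exists2 p, ((N `&` D) `&` [set p | side (G j) p = s j]) p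
    & side (G i) p = s i.
  apply: (side_near (G i) (sP i) iq); apply: filterI => //.
  exact: open_nbhs_nbhs.
have cp : cell (enum 'I_n) s p.
  move=> c _; have [->|ci] := eqVneq c i; first exact: ip.
  have [->|cj] := eqVneq c j; first exact: jp.
  have c0 : sg c u <> 0.
    by apply: (on3 sgS ij); [neq|neq|exact/sg_eq0|exact/sg_eq0].
  by rewrite -su //; apply: Dp.
exists p; split=> //; split; first exact: cell_realization cp.
move=> /bounded_setE[r hr].
have Cr x : cell (enum 'I_n) s x -> `|x| <= r.
  move=> cx; apply: hr; exists (cell (enum 'I_n) s) => //; split=> //.
    exact: cell_realization.
  by apply: cell_connected => //; exact: enum_uniq.
(* Every point of [k] beyond its crossings at the end [b] is within distance 1 of the cell, so a
   bounded cell would make this ray bounded. *)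
apply: (@ray_unbounded _ _ (G k) [set x | `|x| <= r + 1] (bound G k) b);
  last by apply/bounded_setE; exists (r + 1).
move=> t tb /=; set x := param _ _.
have kx : L k x by exact: param_on.
have xs c : c != k -> sg c x = s c.
  move=> ck; rewrite /s (negbTE ck).
  have kc : k != c by neq.
  rewrite (sg_far_point G cross b kc); apply: (sg_beyond cross) => // d dk.
  have := lt_bound G k d; rewrite ltr_norml => /andP[b1 b2].
  by case: (b); [apply: lt_le_trans tb|apply: le_lt_trans b1; rewrite lerN2].
have nx : nbhs x (ball x 1 `&` [set p | forall c, c != k -> sg c p = s c]).
  apply: filterI; first exact: nbhsx_ballx.
  apply: (nbhs_forall (f := fun c p => c != k -> sg c p = s c)) => c.
  have [->|ck] := eqVneq c k; first by apply: nbhs_all => p'; case/eqP.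
  have oc : open [set p | side (G c) p = s c] by apply: side_open.
  by apply: filterS (open_nbhs_nbhs (conj oc (xs c ck))) => p' h _.
have [y [yb ys] yk] := side_near (G k) (sP k) kx nx.
have /Cr yr : cell (enum 'I_n) s y.
  by move=> c _; have [->|ck] := eqVneq c k; [|apply: ys].
have xy : `|x - y| <= 1.
  by move: yb; rewrite -ball_normE /= => /ltW.
have -> : x = (x - y) + y by rewrite subrK.
by apply: le_trans (ler_normD _ _) _; rewrite addrC; apply: lerD.
Qed.

Section NotExterior.
Hypothesis n3 : (3 <= n)%N.

Lemma param_segment_bounded : exists2 r, 0 <= r & forall k p, L k p ->
  `|pos (G k) p| <= bound G k -> `|p| <= r.
Proof.
have hk k : exists r, forall p, L k p -> `|pos (G k) p| <= bound G k -> `|p| <= r.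
  have cK : compact (param (G k) @` `[- bound G k, bound G k]).
    apply: continuous_compact; last exact: segment_compact.
    exact/continuous_subspaceT/param_cont.
  have /bounded_setE[r hr] := compact_bounded cK.
  exists r => p kp; rewrite ler_norml => h; apply: hr.
  by exists (pos (G k) p) => /=; [rewrite in_itv|exact: paramK].
have [f hf] := choice hk.
exists (\sum_k `|f k|) => [|k p kp h]; first exact: sumr_ge0.
apply: le_trans (hf k p kp h) _; apply: le_trans (ler_norm _) _.
by rewrite (bigD1 k) //= lerDl sumr_ge0.
Qed.

Lemma on_outer_face_exterior u : vertices L u -> on_outer_face L u ->
  exterior sg far_point u.
Proof.
move=> [i [j [ij iu ju]]] ou; apply: contrapT => nE.
(* Otherwise [D] is a bounded neighbourhood of [u] with boundary in the drawing. *)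
pose D := [set p | forall c, sg c u <> 0 -> sg c p = sg c u].
have oside c : sg c u <> 0 -> open [set p | side (G c) p = sg c u].
  move=> c0; apply: side_open.
  by case: (sg_cases G c u) c0 => ->; [right| |left].
have oD : open D.
  rewrite openE => p Dp.
  apply: (nbhs_forall (f := fun c p => sg c u <> 0 -> sg c p = sg c u)) => c.
  have [c0|c0] := pselect (sg c u = 0).
    by apply: nbhs_all => y; case.
  by apply: filterS (open_nbhs_nbhs (conj (oside c c0) (Dp c c0))) => y h _.
(* A boundary point lies on some [k] not through [u] and is weakly on the sides of [u]. If it were
   beyond all crossings of [k], that end of [k] would make [u] exterior. So it lies between two
   crossings. *)
have bD q : closure D q -> ~ D q ->
    realization L q /\ exists2 k, L k q & `|pos (G k) q| <= bound G k.
  move=> cq nq.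
  have weak c : sg c u <> 0 -> sg c q = 0 \/ sg c q = sg c u.
    move=> c0; have [|q0] := pselect (sg c q = 0); first by left.
    right; have oc : open [set p | side (G c) p = sg c q].
      by apply: side_open; case: (sg_cases G c q) q0 => ->; [right| |left].
    by have [p [Dp <-]] := cq _ (open_nbhs_nbhs (conj oc erefl)); apply: Dp.
  have [k k0 kq] : exists2 k, sg k u <> 0 & sg k q = 0.
    apply: contrapT => n0; apply: nq => c c0.
    by case: (weak c c0) => // cq0; case: n0; exists c.
  have /(sg_eq0 G) Lkq := kq.
  have notfar b : ~ forall c, c != k -> if b then pos (G k) (crossing k c) < pos (G k) q
                                   else pos (G k) q < pos (G k) (crossing k c).
    move=> h; apply: nE; exists k, b => c c0 ck; have kc : k != c by neq.
    have E : sg c q = sg c (far_point k b).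
      rewrite (sg_far_point G cross b kc) -(paramK (G k) Lkq).
      by apply: (sg_beyond cross).
    by case: (weak c c0); rewrite E // => z; case: (sg_end_neq0 sgS ck z).
  have [c kc hc] : exists2 c, k != c & pos (G k) q <= pos (G k) (crossing k c).
    apply: contrapT => n0; apply: (notfar true) => c ck.
    by rewrite ltNge; apply/negP => h; apply: n0; exists c; [neq|].
  have [c' kc' hc'] : exists2 c, k != c & pos (G k) (crossing k c) <= pos (G k) q.
    apply: contrapT => n0; apply: (notfar false) => d dk.
    by rewrite ltNge; apply/negP => h; apply: n0; exists d; [neq|].
  split; first by apply: (mem_realization Lkq kc' kc); rewrite hc' hc.
  exists k => //; rewrite ler_norml.
  have := lt_bound G k c; have := lt_bound G k c'; rewrite !ltr_norml.
  move=> /andP[b1 _] /andP[_ b2].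
  by rewrite (le_trans (ltW b1) hc') (le_trans hc (ltW b2)).
have openDC S : (forall q, S q -> closure D q -> D q) ->
    forall q, S q -> D q \/ (~` closure D) q.
  move=> h q Sq; have [Dq|] := pselect (D q); first by left.
  by move=> nq; right => /(h q Sq).
have oDC : open (~` closure D) by apply: closed_openC; apply: closed_closure.
have nDC q : D q -> ~ (~` closure D) q by move=> Dq; apply; apply: subset_closure.
have [r r0 hr] := param_segment_bounded.
have [k k0] : exists k, sg k u <> 0.
  apply: contrapT => h; have : (size (enum 'I_n) <= size [:: i; j])%N.
    apply: uniq_leq_size; first exact: enum_uniq.
    move=> c _; rewrite !inE; apply/negPn/negP; rewrite negb_or => /andP[ci cj].
    apply: h; exists c.
    by apply: (on3 sgS ij); [neq|neq|exact/sg_eq0|exact/sg_eq0].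
  by rewrite size_enum_ord leqNgt n3.
(* Outside a large square there are no boundary points of [D], so the connected exterior of the
   square is contained in [D] or disjoint from it. It is not contained in [D], because it contains
   points of the unbounded line [k], which misses [D]. *)
have Dr p : D p -> `|p| <= r.
  move=> Dp; rewrite leNgt; apply/negP => rp.
  have [h|h] : [set p : plane | r < `|p|] `<=` D \/
               [set p : plane | r < `|p|] `<=` ~` closure D.
  - apply: connected_open_cover => //; first exact: norm_exterior_connected.
      apply: openDC => q rq cq; apply: contrapT => nq.
      have [_ [c cq' bq]] := bD q cq nq.
      by have := hr c q cq' bq; rewrite leNgt rq.
    by move=> q [[_ Dq] nq]; apply: (nDC q).
  - apply: (@ray_unbounded _ _ (G k) (L k) 0 true).
      by move=> s _; apply: param_on.
    apply/bounded_setE; exists r => q kq; rewrite leNgt; apply/negP => rq.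
    have := h q rq k k0; have /(sg_eq0 G) -> := kq.
    by move=> /esym.
  - exact: (nDC p Dp (h p rp)).
have [p [[Rp ub] Dp]] : (outer_face L `&` D) !=set0.
  by apply: ou; apply: open_nbhs_nbhs.
apply: ub; apply/bounded_setE; exists r => q Kq; apply: Dr.
have Kp : connected_component (~` realization L) p p.
  exact: connected_component_refl.
(* The component of [p] avoids the drawing and thus the boundary of [D], so it stays in the bounded
   set [D], against its unboundedness. *)
have [h|h] : connected_component (~` realization L) p `<=` D \/
             connected_component (~` realization L) p `<=` ~` closure D.
- apply: connected_open_cover => //; first exact: component_connected.
    apply: openDC => x Kx cx; apply: contrapT => nx.
    have [Rx _] := bD x cx nx.
    by have := connected_component_sub Kx; apply.
  by move=> x [[_ Dx] nx]; apply: (nDC x).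
- exact: h.
- by case: (nDC p Dp (h p Kp)).
Qed.
End NotExterior.
End OuterFace.

Theorem theorem2 (R : realType) (n : nat) (L : 'I_n -> set (R * R)) (v : R * R)
    (hn : (3 <= n)%N) (hL : simple_arrangement L) (hv : vertices L v) :
  diametrical L v <-> on_outer_face L v.
Proof.
have [hP cross simple] := hL.
have hG i : exists _ : chart (L i), True.
  by have [g] := pseudoline_chart (hP i); exists g.
pose G i := projT1 (cid (hG i)).
apply: iff_trans (diametricalE G cross simple hn hv) _; split.
  exact: exterior_on_outer_face.
exact: on_outer_face_exterior.
Qed.
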